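(* Let a Markov chain on a measurable space $(X,\Sigma)$ satisfy $\dim\Delta_{ba}=1$, $\Delta_{ba}=\{\mu\}$, $\mu=A\mu$. For $\eta\in S_{ca}$ put $\lambda_n^\eta=\frac1n\sum_{k=1}^n A^k\eta$ and $\mu_n=A^n\eta$, $n\in\mathbb{N}$. Then $$\|\lambda_n^\eta-\mu\|\to 0\quad\text{as } n\to\infty$$ uniformly over the initial measures $\eta\in S_{ca}$. If, in addition, the measure $\mu$ is simple, i.e. the Markov chain has no cycles, then $$\|\mu_n-\mu\|\to 0\quad\text{as } n\to\infty$$ uniformly over the initial measures $\eta\in S_{ca}$.
   Context: $X$ is an arbitrary infinite set and $\Sigma$ is a $\sigma$-algebra of subsets of $X$ containing all singletons. $B(X,\Sigma)$ is the Banach space of bounded $\Sigma$-measurable functions $f:X\to\mathbb{R}$ with the sup-norm. $ba(X,\Sigma)$ is the Banach space of bounded finitely additive measures $\mu:\Sigma\to\mathbb{R}$ with the total variation norm $\|\cdot\|$, and $ca(X,\Sigma)$ is its subspace of countably additive measures. $S_{ba}=\{\mu\in ba(X,\Sigma):\mu\ge 0,\ \|\mu\|=1\}$, $S_{ca}=S_{ba}\cap ca(X,\Sigma)$. A Markov chain is given by a transition function $p(x,E)$, $x\in X$, $E\in\Sigma$, with $0\le p(x,E)\le 1$, $p(x,X)=1$, $p(\cdot,E)\in B(X,\Sigma)$ for all $E\in\Sigma$, and $p(x,\cdot)\in ca(X,\Sigma)$ for all $x\in X$. The Markov operator $A:ba(X,\Sigma)\to ba(X,\Sigma)$ is $A\mu(E)=\int_X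 p(x,E)\,\mu(dx)$. $\Delta_{ba}=\{\mu\in S_{ba}: A\mu=\mu\}$, and $\dim\Delta_{ba}$ is the dimension of its linear span. A cycle of the chain is a finite family of pairwise distinct measures $\mu_1,\dots,\mu_r\in S_{ba}$, $r\ge 2$, with $A\mu_i=\mu_{i+1}$ for $1\le i<r$ and $A\mu_r=\mu_1$. When $\Delta_{ba}=\{\mu\}$, the measure $\mu$ is called simple if it is not a weighted sum $\frac1r\sum_{i=1}^r\mu_i$ of the measures of one cycle, i.e. if the chain has no cycles of finitely additive (in particular, countably additive) measures. *)

(* Defs.v *)
From HB Require Import structures.
From mathcomp Require Import all_boot all_order all_algebra.
From mathcomp Require Import all_classical all_reals all_analysis.

Set Implicit Arguments.
Unset Strict Implicit.
Unset Printing Implicit Defensive.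

Import Order.TTheory GRing.Theory Num.Theory.
Import numFieldNormedType.Exports.
Import HBSimple.

Local Open Scope classical_set_scope.
Local Open Scope ring_scope.

Section LinearSpan.
Context (R : realType) (V : lmodType R).

Definition lin_span (S : set V) : set V :=
  [set v | exists n (c : 'I_n -> R) (s : 'I_n -> V),
    (forall i, S (s i)) /\ v = \sum_(i < n) c i *: s i].

Definition lin_indep n (b : 'I_n -> V) : Prop :=
  forall c : 'I_n -> R, \sum_(i < n) c i *: b i = 0 -> forall i, c i = 0.

Definition has_span_dim (S : set V) (n : nat) : Prop :=
  exists b : 'I_n -> V, lin_indep b /\ lin_span (range b) = lin_span S.

End LinearSpan.

(* A real function on the sigma-algebra is encoded as a total function on
   [set X] that vanishes on the nonmeasurable sets (see [ba]), so that Leibniz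
   equality is equality on the sigma-algebra; [R^o] is [R] seen as an
   [R]-module, which makes this type an [R]-module pointwise. *)
Notation setfun X R := (set X -> R^o).

Section FinitelyAdditiveMeasures.
Context d (X : measurableType d) (R : realType).

Implicit Types (mu : setfun X R) (E : set X).

Definition ba : set (setfun X R) :=
  [set mu : setfun X R | [/\ forall E, ~ measurable E -> mu E = 0,
                additive2 (fun E => (mu E)%:E) &
                exists M : R, forall E, measurable E -> `|mu E| <= M ] ].

Definition ca : set (setfun X R) :=
  [set mu : setfun X R | ba mu /\ semi_sigma_additive (fun E => (mu E)%:E)].

(* It is extended-real-valued, hence meaningful outside [ba] too. *)
Definition tv_norm mu : \bar R :=
  ereal_sup [set t | exists n (E : 'I_n -> set X),
    [/\ forall i, measurable (E i), trivIset [set: 'I_n] E &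
        t = (\sum_(i < n) `|mu (E i)|)%:E ] ].

Definition S_ba : set (setfun X R) :=
  [set mu : setfun X R | [/\ ba mu, forall E, measurable E -> 0 <= mu E &
                tv_norm mu = 1%:E ] ].

Definition S_ca : set (setfun X R) := S_ba `&` ca.

(* The integral of a bounded measurable function against a finitely additive
   measure (the library's integral is the Lebesgue one, for countably additive
   positive measures): the limit of the integrals of simple functions that
   converge uniformly to it. For [mu] in [ba] and [f] bounded and measurable,
   this limit exists and does not depend on the approximating sequence. *)
Definition is_ba_integral mu (f : X -> R) (I : R) : Prop :=
  exists h : nat -> {sfun X >-> R},
    {uniform, (fun n => h n : X -> R) @ \oo --> f} /\
    sintegral (fun E => (mu E)%:E) (h n) @[n --> \oo] --> I%:E.

Definition ba_integral mu (f : X -> R) : R := xget 0 (is_ba_integral mu f).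

End FinitelyAdditiveMeasures.

Arguments ba {d} X R.
Arguments ca {d} X R.
Arguments S_ba {d} X R.
Arguments S_ca {d} X R.

Section MarkovChain.
Context d (X : measurableType d) (R : realType) (p : R.-pker X ~> X).

Definition markov_op (mu : setfun X R) : setfun X R :=
  fun E => if `[< measurable E >] then ba_integral mu (fun x => fine (p x E))
           else 0.

Definition Delta_ba : set (setfun X R) :=
  [set mu : setfun X R | S_ba X R mu /\ markov_op mu = mu].

(* [ordS] is the cyclic successor, so the last measure is sent to the first. *)
Definition is_cycle r (m : 'I_r -> setfun X R) : Prop :=
  [/\ (2 <= r)%N, injective m, forall i, S_ba X R (m i) &
      forall i, markov_op (m i) = m (ordS i) ].

(* If [mu] is the only element of [Delta_ba], this amounts to the absence of
   cycles, since the average of the measures of a cycle is in [Delta_ba]. *)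
Definition simple_measure (mu : setfun X R) : Prop :=
  ~ exists r (m : 'I_r -> setfun X R),
      is_cycle m /\ mu = r%:R^-1 *: \sum_(i < r) m i.

Definition markov_iter (n : nat) (eta : setfun X R) : setfun X R :=
  iter n markov_op eta.

Definition cesaro_mean (n : nat) (eta : setfun X R) : setfun X R :=
  n%:R^-1 *: \sum_(1 <= k < n.+1) markov_iter k eta.

Definition unif_tv_cvg (u : nat -> setfun X R -> setfun X R)
    (mu : setfun X R) : Prop :=
  forall e : R, 0 < e ->
    \forall n \near \oo, forall eta, S_ca X R eta ->
      (tv_norm (u n eta - mu)%R < e%:E)%E.

End MarkovChain.

(* Main.v *)
(* A positive normalized linear functional ("state") [F] on the space of bounded
   measurable functions carries the same data as a measure [mu] in [S_ba]:
   [mu E = F 1_E].  The Markov operator then becomes [F |-> F \o P], with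
   [P f x] the integral of [f] against [p x].  Let [M] be the unique invariant
   state.

   Cesaro means.  An ultralimit of states [f |-> avg n P f x_n] is invariant,
   hence equal to [M]; so [avg n P f] converges to [M f] uniformly, for each
   fixed [f].  A gliding hump makes [M] countably additive, and the means are
   then uniformly absolutely continuous with respect to [M] (Doeblin's
   condition).  It is enough to show that an almost invariant function [h],
   [|h| <= 1], is close to the constant [M h].  At a fixed point [x], the [h]
   with [|P h - h| <= 1/n] and [h x - M h >= c] form decreasing convex sets;
   near-minimizers of [M (h ^ 2)] in them are Cauchy in [L^2 (M)], which by
   Doeblin's condition contradicts the convergence of the means of one of them.
   Pointwise convergence to [0] of [h_n - M h_n] becomes convergence in
   [M]-measure, hence, by Doeblin's condition again, uniform convergence.

   Powers.  Without cycles [M] is the only invariant state of every power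
   [P^r], so the above applies to all of them: each lazy operator
   [(1 + P^r) / 2] has a power that contracts the kernel of [M].  The uniform
   convergence for [P] yields [N] such that [|P^(2N) g| <= 1 - (1 - b) / 4] as
   soon as [|g| <= 1] and [|(1 + P^r) / 2 g| <= b] for all [0 < r < 2N].
   Iterating brings in products of many lazy operators, in which one of them
   occurs often; thus a power of [P] contracts the kernel of [M]. *)

Require Import Defs.
From HB Require Import structures.
From mathcomp Require Import all_boot all_order all_algebra.
From mathcomp Require Import all_classical all_reals all_analysis.
From mathcomp Require Import measurable_realfun zify ring lra.

Set Implicit Arguments.
Unset Strict Implicit.
Unset Printing Implicit Defensive.

Import Order.TTheory GRing.Theory Num.Theory.
Import numFieldNormedType.Exports.
Import HBSimple.

Local Open Scope classical_set_scope.
Local Open Scope ring_scope.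

(** * Bounded measurable functions *)

Section BoundedMeasurable.
Context d (X : measurableType d) (R : realType).

Definition bmfun_pred : {pred X -> R^o} :=
  mem [set f : X -> R^o | measurable_fun setT (f : X -> R) /\
                          exists C : R, forall x, `|f x| <= C].

Lemma bmfun_submod_closed : submod_closed bmfun_pred.
Proof.
split=> [|a f g]; rewrite !inE.
  by split; [exact: measurable_cst | exists 0 => x; rewrite normr0].
move=> [mf [C fC]] [mg [D gD]]; split.
  by apply: measurable_funD => //; apply: measurable_funM.
exists (`|a| * C + D) => x; rewrite fctE (le_trans (ler_normD _ _))// lerD//.
by rewrite normrM ler_wpM2l.
Qed.

HB.instance Definition _ :=
  GRing.isSubmodClosed.Build _ _ bmfun_pred bmfun_submod_closed.

Record bmfun := Bmfun { bmfun_val : X -> R^o; _ : bmfun_val \in bmfun_pred }.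

HB.instance Definition _ := [isSub for bmfun_val].
HB.instance Definition _ := [Choice of bmfun by <:].
HB.instance Definition _ := [SubChoice_isSubLmodule of bmfun by <:].

Definition bmfun_fun (f : bmfun) : X -> R := bmfun_val f.
Coercion bmfun_fun : bmfun >-> Funclass.

(* Junk value: [mkb f] is [0] when [f] is not measurable and bounded. *)
Definition mkb (f : X -> R) : bmfun := insubd 0 (f : X -> R^o).

Implicit Types f g : bmfun.

Lemma bmfunP f g : (forall x, f x = g x) -> f = g.
Proof. by move=> fg; apply/val_inj/funext. Qed.

Lemma bmfun_meas f : measurable_fun setT (f : X -> R).
Proof. by case: f => f fP; have := fP; rewrite inE => -[]. Qed.

Lemma bmfun_bounded f : exists C : R, forall x, `|f x| <= C.
Proof. by case: f => f fP; have := fP; rewrite inE => -[]. Qed.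

Lemma mkbE (u : X -> R) C : measurable_fun setT u ->
  (forall x, `|u x| <= C) -> mkb u = u :> (X -> R).
Proof.
by move=> mu uC; rewrite /bmfun_fun /mkb insubdK // inE; split=> //; exists C.
Qed.

Lemma bmfun_add f g x : (f + g) x = f x + g x. Proof. by []. Qed.
Lemma bmfun_opp f x : (- f) x = - f x. Proof. by []. Qed.
Lemma bmfun_scale (a : R) f x : (a *: f) x = a * f x. Proof. by []. Qed.
Lemma bmfun_zero x : (0 : bmfun) x = 0. Proof. by []. Qed.
Lemma bmfun_sum I (r : seq I) (P : pred I) (F : I -> bmfun) x :
  (\sum_(i <- r | P i) F i) x = \sum_(i <- r | P i) F i x.
Proof. by apply: (big_morph (fun f : bmfun => f x)). Qed.

Definition indb (E : set X) : bmfun := mkb \1_E.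
Definition oneb : bmfun := indb setT.

Lemma indbE E x : measurable E -> indb E x = (x \in E)%:R.
Proof.
move=> mE; have mi : measurable_fun setT (\1_E : X -> R) by exact: measurable_indic.
rewrite /indb (mkbE mi (_ : forall y, _ <= 1)) ?indicE // => y.
by rewrite indicE; case: (_ \in _); rewrite ?normr1 ?normr0.
Qed.

Lemma onebE x : oneb x = 1.
Proof. by rewrite indbE // in_setT. Qed.

Definition bmfunE :=
  (bmfun_add, bmfun_opp, bmfun_scale, bmfun_zero, bmfun_sum, onebE).

Definition sqb f : bmfun := mkb (fun x => f x ^+ 2).
Definition absb f : bmfun := mkb (fun x => `|f x|).

Lemma sqbE f x : sqb f x = f x ^+ 2.
Proof.
have [C fC] := bmfun_bounded f.
have mf := measurable_funX 2 (bmfun_meas f).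
rewrite /sqb (mkbE mf (_ : forall y, _ <= C ^+ 2)) // => y.
by rewrite normrX ler_sqr ?nnegrE // (le_trans _ (fC y)).
Qed.

Lemma absbE f x : absb f x = `|f x|.
Proof.
have [C fC] := bmfun_bounded f.
have mf : measurable_fun setT (fun x => `|f x|).
  by apply: measurableT_comp => //; exact: bmfun_meas.
by rewrite /absb (mkbE mf (_ : forall y, _ <= C)) // => y; rewrite normr_id.
Qed.

Lemma measurable_bmfun_gt f (c : R) : measurable [set x | c < f x].
Proof.
have := bmfun_meas f measurableT (measurable_itv `]c, +oo[).
rewrite setTI; congr measurable; apply/seteqP; split=> x /=;
  by rewrite in_itv /= andbT.
Qed.

End BoundedMeasurable.
Arguments bmfun {d} X R.
Arguments oneb {d X R}.
Arguments bmfun_fun : simpl never.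

(** * States and Markov operators *)

Section States.
Context d (X : measurableType d) (R : realType).
Local Notation V := (bmfun X R).
Implicit Types (F G : V -> R) (P Q : V -> V) (f g h : V) (E : set X).

Definition state F := [/\ forall a f g, F (a *: f + g) = a * F f + F g,
  forall f, (forall x, 0 <= f x) -> 0 <= F f & F oneb = 1].

Lemma state_eval x : state (fun f => f x).
Proof. by split=> [a f g||]; rewrite ?bmfunE. Qed.

Section StateTheory.
Variable F : V -> R.
Hypothesis sF : state F.

Lemma state0 : F 0 = 0.
Proof.
by have [lF _ _] := sF; have := lF (-1) 0 0; rewrite scaler0 addr0; lra.
Qed.

Lemma stateD f g : F (f + g) = F f + F g.
Proof. by have [lF _ _] := sF; have := lF 1 f g; rewrite scale1r mul1r. Qed.

Lemma stateZ a f : F (a *: f) = a * F f.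
Proof. by have [lF _ _] := sF; rewrite -[a *: f]addr0 lF state0 addr0. Qed.

Lemma stateN f : F (- f) = - F f.
Proof. by rewrite -scaleN1r stateZ mulN1r. Qed.

Lemma stateB f g : F (f - g) = F f - F g.
Proof. by rewrite stateD stateN. Qed.

Lemma state_one : F oneb = 1.
Proof. by case: sF. Qed.

Lemma state_sum I (r : seq I) (p : pred I) (u : I -> V) :
  F (\sum_(i <- r | p i) u i) = \sum_(i <- r | p i) F (u i).
Proof. exact: (big_morph F stateD state0). Qed.

Lemma state_le f g : (forall x, f x <= g x) -> F f <= F g.
Proof.
have [_ pF _] := sF => fg; rewrite -subr_ge0 -stateB; apply: pF => x.
by rewrite !bmfunE subr_ge0.
Qed.

Lemma state_le_cst f c : (forall x, f x <= c) -> F f <= c.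
Proof.
move=> fc; rewrite -[leRHS]mulr1 -state_one -stateZ; apply: state_le => x.
by rewrite !bmfunE mulr1.
Qed.

Lemma state_ge_cst f c : (forall x, c <= f x) -> c <= F f.
Proof.
move=> fc; rewrite -lerN2 -stateN; apply: state_le_cst => x.
by rewrite !bmfunE lerN2.
Qed.

Lemma state_norm_le f c : (forall x, `|f x| <= c) -> `|F f| <= c.
Proof.
move=> fc; rewrite ler_norml state_ge_cst ?state_le_cst // => x;
  by have := fc x; rewrite ler_norml => /andP[].
Qed.

Lemma state_le_indb f E e c : measurable E ->
  (forall x, f x <= e + c * (x \in E)%:R) -> F f <= e + c * F (indb R E).
Proof.
move=> mE fE; rewrite -[e in leRHS]mulr1 -state_one -!stateZ -stateD.
by apply: state_le => x; rewrite !bmfunE indbE // mulr1.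
Qed.

(** Chebyshev's inequality when [c = 0], by monotonicity of the state. *)
Lemma state_markov_ineq f E e c : measurable E -> (forall x, e * (x \in E)%:R + c <= f x) ->
  e * F (indb R E) + c <= F f.
Proof.
move=> mE fE; rewrite -[c]mulr1 -state_one -!stateZ -stateD.
by apply: state_le => x; rewrite !bmfunE indbE // mulr1.
Qed.

Lemma state_indb_le E E' : measurable E -> measurable E' -> E `<=` E' ->
  F (indb R E) <= F (indb R E').
Proof.
move=> mE mE' EE'; apply: state_le => x; rewrite !indbE //.
by have [/set_mem/EE'/mem_set->|] := boolP (x \in E).
Qed.

Lemma state_indb_ge0 E : 0 <= F (indb R E).
Proof.
have [_ pF _] := sF; apply: pF => x.
by rewrite /bmfun_fun /indb /mkb /insubd; case: insubP => [u _ /= ->|_] //; rewrite indicE.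
Qed.

Lemma state_indbU E E' : measurable E -> measurable E' -> E `&` E' = set0 ->
  F (indb R (E `|` E')) = F (indb R E) + F (indb R E').
Proof.
move=> mE mE' EE'; rewrite -stateD; congr F; apply: bmfunP => x.
rewrite bmfunE !indbE //; last exact: measurableU.
rewrite in_setU; case: (boolP (x \in E)) => xE; case: (boolP (x \in E')) => xE' /=;
  rewrite ?addr0 ?add0r //.
have : (E `&` E') x by split; exact: set_mem.
by rewrite EE'.
Qed.

Lemma state_indbU_le E E' : measurable E -> measurable E' ->
  F (indb R (E `|` E')) <= F (indb R E) + F (indb R E').
Proof.
move=> mE mE'; rewrite -stateD; apply: state_le => x.
rewrite bmfunE !indbE //; last exact: measurableU.
by rewrite in_setU; case: (x \in E); case: (x \in E'); rewrite /= ?addr0 ?add0r // lerDl.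
Qed.

Lemma state_indb_bigU (E : nat -> set X) n : (forall i, measurable (E i)) ->
  F (indb R (\big[setU/set0]_(i < n) E i)) <= \sum_(i < n) F (indb R (E i)).
Proof.
move=> mE; elim: n => [|n IH].
  rewrite !big_ord0 (_ : indb R set0 = 0) ?state0 //.
  by apply: bmfunP => x; rewrite indbE // in_set0.
rewrite !big_ord_recr /= (le_trans (state_indbU_le _ _)) ?lerD2r //.
by apply: bigsetU_measurable.
Qed.

End StateTheory.

Definition markov P := forall x, state (fun f => P f x).

Lemma markov_linear P : markov P -> forall a f g, P (a *: f + g) = a *: P f + P g.
Proof.
by move=> mP a f g; apply: bmfunP => x; have [lP _ _] := mP x; rewrite lP !bmfunE.
Qed.

Lemma markov_one P : markov P -> P oneb = oneb.
Proof. by move=> mP; apply: bmfunP => x; have [_ _ ->] := mP x; rewrite bmfunE. Qed.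

Lemma state_comp F P : state F -> markov P -> state (F \o P).
Proof.
move=> [lF pF F1] mP; split=> [a f g|f f0|] /=.
- by rewrite markov_linear ?lF.
- by apply: pF => x; have [_ pP _] := mP x; exact: pP.
- by rewrite markov_one.
Qed.

Lemma markov_comp P Q : markov P -> markov Q -> markov (P \o Q).
Proof. by move=> mP mQ x; apply: (state_comp (mP x) mQ). Qed.

Lemma markov_pow n P : markov P -> markov (iter n P).
Proof.
move=> mP; elim: n => [|n IH]; first exact: state_eval.
exact: (markov_comp mP IH).
Qed.

Lemma markovD P (mP : markov P) f g : P (f + g) = P f + P g.
Proof. by apply: bmfunP => x; rewrite (stateD (mP x)). Qed.
Lemma markovZ P (mP : markov P) a f : P (a *: f) = a *: P f.
Proof. by apply: bmfunP => x; rewrite (stateZ (mP x)). Qed.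
Lemma markovN P (mP : markov P) f : P (- f) = - P f.
Proof. by apply: bmfunP => x; rewrite (stateN (mP x)). Qed.
Lemma markovB P (mP : markov P) f g : P (f - g) = P f - P g.
Proof. by apply: bmfunP => x; rewrite (stateB (mP x)). Qed.
Lemma markov_sum P (mP : markov P) I (r : seq I) (p : pred I) (u : I -> V) :
  P (\sum_(i <- r | p i) u i) = \sum_(i <- r | p i) P (u i).
Proof.
by apply: bmfunP => x; rewrite (state_sum (mP x)) bmfunE.
Qed.

(** The sum starts at [P f], as in [cesaro_mean]; order [0] gives [0], because [0^-1 = 0]. *)
Definition avg n P f : V :=
  locked (n%:R^-1 *: \sum_(1 <= k < n.+1) iter k P f).

Lemma avg_def n P f : avg n P f = n%:R^-1 *: \sum_(1 <= k < n.+1) iter k P f.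
Proof. by rewrite /avg -lock. Qed.

Lemma avgE n P f x : avg n P f x = n%:R^-1 * \sum_(1 <= k < n.+1) iter k P f x.
Proof. by rewrite avg_def !bmfunE. Qed.

Lemma sum_cst_nat n (c : R) : \sum_(1 <= k < n.+1) c = n%:R * c.
Proof. by rewrite sumr_const_nat subSS subn0 mulr_natl. Qed.

Lemma state_mean n (F : nat -> V -> R) : (0 < n)%N -> (forall k, state (F k)) ->
  state (fun f => n%:R^-1 * \sum_(1 <= k < n.+1) F k f).
Proof.
move=> n0 sF; have n0' : n%:R != 0 :> R by rewrite pnatr_eq0 -lt0n.
split=> [a f g|f f0|].
- rewrite mulrCA -mulrDr; congr *%R; rewrite mulr_sumr -big_split /=.
  by apply: eq_bigr => k _; have [-> _ _] := sF k.
- rewrite mulr_ge0 ?invr_ge0 // sumr_ge0 // => k _.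
  by have [_ + _] := sF k; apply.
- rewrite (eq_bigr (fun=> 1)) ?sum_cst_nat ?mulr1 ?mulVf //.
  by move=> k _; have [] := sF k.
Qed.

Lemma markov_avg n P : (0 < n)%N -> markov P -> markov (avg n P).
Proof.
move=> n0 mP x; have := state_mean n0 (fun k => markov_pow k mP x).
by congr state; apply/funext => f; rewrite avgE.
Qed.

Lemma iter_comm n P f : iter n P (P f) = P (iter n P f).
Proof. by rewrite -iterSr. Qed.

Lemma avg_comm n P f : markov P -> avg n P (P f) = P (avg n P f).
Proof.
move=> mP; rewrite !avg_def (markovZ mP) (markov_sum mP); congr (_ *: _).
by apply: eq_bigr => k _; rewrite iter_comm.
Qed.

(** The sum telescopes to [P^(n+1) f - P f], of norm at most [2 C]. *)
Lemma avg_inv n P f C : markov P -> (forall x, `|f x| <= C) ->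
  forall x, `|avg n P (P f - f) x| <= 2 * C / n%:R.
Proof.
move=> mP fC x; rewrite avgE (eq_bigr (fun k => iter k.+1 P f x - iter k P f x)).
  rewrite telescope_sumr // normrM mulrC normfV normr_nat.
  rewrite ler_wpM2r ?invr_ge0 // (le_trans (ler_normB _ _)) // mulr_natl mulr2n.
  by rewrite lerD // (state_norm_le (markov_pow _ mP x)).
move=> k _; rewrite (stateB (markov_pow k mP x)) /= -iter_comm //.
Qed.

Lemma avg_defect n P f C : markov P -> (forall x, `|f x| <= C) ->
  forall x, `|(P (avg n P f) - avg n P f) x| <= 2 * C / n%:R.
Proof.
move=> mP fC; case: n => [|n] x.
  by rewrite invr0 mulr0 avg_def invr0 scale0r subr0 (state0 (mP x)) normr0.
have := avg_inv n.+1 mP fC x.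
by rewrite (markovB (markov_avg _ mP)) // avg_comm.
Qed.

Lemma iter_drift n P h e : markov P -> (forall x, `|(P h - h) x| <= e) ->
  forall x, `|(iter n P h - h) x| <= n%:R * e.
Proof.
move=> mP he x; elim: n => [|n IH]; first by rewrite /= subrr normr0 mul0r.
rewrite -natr1 mulrDl mul1r.
have -> : (iter n.+1 P h - h) x = (iter n P (P h - h) + (iter n P h - h)) x.
  by rewrite (markovB (markov_pow n mP)) iter_comm iterS !bmfunE; lra.
rewrite bmfunE (le_trans (ler_normD _ _)) // addrC lerD //.
exact: (state_norm_le (markov_pow n mP x)).
Qed.

(** Each term [P^k h], [k <= n], is within [k e] of [h]. For fixed [n], a function nearly fixed by
    [P] is thus nearly fixed by [avg n P]. *)
Lemma avg_drift n P h e : (0 < n)%N -> markov P -> (forall x, `|(P h - h) x| <= e) ->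
  forall x, `|(avg n P h - h) x| <= n%:R * e.
Proof.
move=> n0 mP he x; have n0' : (0 : R) < n%:R by rewrite ltr0n.
have -> : (avg n P h - h) x = n%:R^-1 * \sum_(1 <= k < n.+1) (iter k P h - h) x.
  rewrite bmfun_add avgE.
  under [in RHS]eq_bigr do rewrite bmfun_add.
  by rewrite big_split /= mulrDr sum_cst_nat mulKf // gt_eqF.
rewrite normrM normfV normr_nat ler_pdivrMl //.
rewrite (le_trans (ler_norm_sum _ _ _)) // -sum_cst_nat.
apply: ler_sum_nat => k /andP[_ kn]; rewrite (le_trans (iter_drift k mP he x)) //.
by rewrite ler_wpM2r ?ler_nat // (le_trans _ (he x)).
Qed.

End States.

(** * Cesaro means *)

Section Ultralimit.
Context d (X : measurableType d) (R : realType).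
Local Notation V := (bmfun X R).

(** For each [f] the values [F n f] stay in a compact segment, so they converge along an ultrafilter
    finer than [\oo]. Only upper bounds are recorded; lower ones follow by passing to [- f]. *)
Lemma state_ulimit (F : nat -> V -> R) : (forall n, state (F n)) ->
  exists G, state G /\ forall f c N, (forall n, (N <= n)%N -> F n f <= c) -> G f <= c.
Proof.
move=> sF; have [U [UU sU]] := ultraFilterLemma (@eventually_filter : ProperFilter \oo).
pose G f : R := lim (F n f @[n --> U]).
have cF f : F n f @[n --> U] --> G f.
  have [C fC] := bmfun_bounded f.
  have cptC := @segment_compact R (- C) C.
  have UF : UltraFilter (F n f @[n --> U]).
    split=> [|H PH sH]; first exact: fmap_proper_filter.
    rewrite eqEsubset; split=> // A HA.
    have [//|UnA] := in_ultra_setVsetC ((F^~ f) @^-1` A) UU.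
    have : H (~` A) by apply: sH.
    by move/(filterI HA); rewrite setICr => /filter_ex[].
  have : (F n f @[n --> U]) `[- C, C]%classic.
    apply: (@filterE _ U) => n /=.
    by rewrite in_itv /= -ler_norml (state_norm_le (sF n)).
  move: cptC; rewrite compact_ultra => /(_ _ UF) + h => /(_ h)[l [_ /= Fl]].
  by apply/cvgP; exact: Fl.
have PU : ProperFilter U := ultra_proper.
exists G; split; last first.
  move=> f c N fc; apply: (limr_le (cvgP _ (cF f))).
  by apply: sU; exists N.
split=> [a f g|f f0|].
- apply: cvg_lim => //.
  under eq_cvg do rewrite (stateD (sF _)) (stateZ (sF _)).
  by apply: cvgD => //; apply: cvgMr.
- apply: (limr_ge (cvgP _ (cF f))); near=> n.
  by have [_ + _] := sF n; apply.
- apply: cvg_lim => //; under eq_cvg do rewrite (state_one (sF _)).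
  exact: cvg_cst.
Unshelve. all: by end_near. Qed.

End Ultralimit.

(** * Limits of means, countable additivity of the unique invariant state, Doeblin's condition *)

Section UniqueInvariantState.
Context d (X : measurableType d) (R : realType).
Local Notation V := (bmfun X R).
Implicit Types (f g h : V) (E : set X).

(** Countable additivity, in the form of dominated convergence. *)
Definition sigma_state (F : V -> R) := forall u : nat -> V,
  (forall n x, 0 <= u n x <= 1) ->
  (forall x, u n x @[n --> \oo] --> (0 : R)) -> F (u n) @[n --> \oo] --> (0 : R).

Definition invariant_state (P : V -> V) (F : V -> R) :=
  state F /\ forall f, F (P f) = F f.

Lemma small_div (C e : R) : 0 <= C -> 0 < e ->
  exists N, forall n, (N <= n)%N -> C / n.+1%:R <= e.
Proof.
move=> C0 e0; exists (Num.bound (C / e)) => n Nn.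
rewrite ler_pdivrMr ?ltr0n // mulrC -ler_pdivrMr //.
rewrite (le_trans (ltW (archi_boundP _))) ?divr_ge0 ?(ltW e0) // ler_nat.
exact: leq_trans Nn _.
Qed.

(** By [avg_inv] the means of [P f - f] are at most [2 C / n_ k], which tends to [0] since
    [k < n_ k]; so their ultralimit vanishes on [P f - f]. *)
Lemma avg_limit_invariant (P : V -> V) (n_ : nat -> nat) (x_ : nat -> X) :
  markov P -> (forall k, (k < n_ k)%N) ->
  exists G, invariant_state P G /\ forall f c N,
    (forall k, (N <= k)%N -> avg (n_ k) P f (x_ k) <= c) -> G f <= c.
Proof.
move=> mP nk.
have n0 k : (0 < n_ k)%N by exact: leq_ltn_trans (leq0n k) (nk k).
have [G [sG GP]] := state_ulimit (fun k => markov_avg (n0 k) mP (x_ k)).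
exists G; split=> //; split=> // f.
have [C fC] := bmfun_bounded f.
have C0 : 0 <= 2 * C by rewrite mulr_ge0 // (le_trans _ (fC (x_ 0))).
have small g c : (forall k, `|avg (n_ k) P g (x_ k)| <= 2 * C / (n_ k)%:R) ->
    0 < c -> G g <= c.
  move=> gk c0; have [N Nc] := small_div C0 c0.
  apply: (GP _ _ N) => k Nk; rewrite (le_trans (ler_norm _)) //.
  apply: le_trans (gk k) (le_trans _ (Nc _ Nk)).
  by rewrite ler_wpM2l // lef_pV2 ?posrE ?ltr0n // ler_nat.
have h1 := fun k => avg_inv (n_ k) mP fC (x_ k).
apply/eqP; rewrite -subr_eq0 -(stateB sG) eq_le; apply/andP; split.
  by apply/ler_addgt0Pr => c c0; rewrite add0r; exact: small.
rewrite -oppr_le0 -(stateN sG); apply/ler_addgt0Pr => c c0; rewrite add0r.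
apply: small c0 => k.
by rewrite (markovN (markov_avg (n0 k) mP)) bmfun_opp normrN.
Qed.

Variables (P : V -> V) (M : V -> R).
Hypotheses (mP : markov P) (iM : invariant_state P M).
Hypothesis uniqM : forall G, invariant_state P G -> forall f, G f = M f.

Let sM : state M. Proof. by case: iM. Qed.

Lemma invariant_iter n f : M (iter n P f) = M f.
Proof. by elim: n f => //= n IH f; have [_ ->] := iM. Qed.

Lemma invariant_avg n f : (0 < n)%N -> M (avg n P f) = M f.
Proof.
move=> n0; rewrite avg_def (stateZ sM) (state_sum sM).
rewrite (eq_bigr (fun=> M f)) => [|k _]; last exact: invariant_iter.
by rewrite sum_cst_nat mulKf // pnatr_eq0 -lt0n.
Qed.

(** Otherwise means of arbitrarily large order exceed [M f + e] at some points, and their ultralimit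
    is an invariant state other than [M]. *)
Lemma avg_upper f e : 0 < e ->
  exists N, forall n, (N <= n)%N -> forall x, avg n P f x <= M f + e.
Proof.
move=> e0; apply: contrapT => /forallNP H.
have /choice[nx Hnx] (k : nat) : exists nx : nat * X, (k < nx.1)%N /\
    M f + e < avg nx.1 P f nx.2.
  have /existsNP[n /not_implyP[kn /existsNP[x /negP]]] := H k.+1.
  by rewrite -ltNge => fx; exists (n, x).
have [G [iG GP]] :=
  avg_limit_invariant (fun k => (nx k).2) mP (fun k => proj1 (Hnx k)).
have n0 k : (0 < (nx k).1)%N by exact: leq_ltn_trans (leq0n k) (proj1 (Hnx k)).
have : G (- f) <= - (M f + e).
  apply: (GP _ _ 0) => k _.
  rewrite (markovN (markov_avg (n0 k) mP)) bmfun_opp lerN2 ltW //.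
  by case: (Hnx k).
rewrite (stateN (proj1 iG)) (uniqM iG) lerN2 gerDl leNgt e0 //.
Qed.

Lemma avg_cvg f e : 0 < e ->
  exists N, forall n, (N <= n)%N -> forall x, `|avg n P f x - M f| <= e.
Proof.
move=> e0; have [N1 H1] := avg_upper f e0; have [N2 H2] := avg_upper (- f) e0.
exists (maxn 1 (maxn N1 N2)) => n; rewrite !geq_max => /and3P[n0 n1 n2] x.
move: (H1 n n1 x) (H2 n n2 x).
rewrite (markovN (markov_avg n0 mP)) bmfun_opp (stateN sM) ler_norml.
move: (avg n P f x) (M f) => a b ? ?.
by apply/andP; split; lra.
Qed.

Hypothesis sigmaP : forall x, sigma_state (fun f => P f x).

Lemma sigma_iter k x : sigma_state (fun f => iter k P f x).
Proof.
elim: k x => [|k IH] x u u01 u0; first exact: u0.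
apply: (@sigmaP x (fun n => iter k P (u n))) => [n y|y]; last exact: IH.
rewrite (state_ge_cst (markov_pow k mP y)) ?(state_le_cst (markov_pow k mP y)) //;
  by move=> z; case/andP: (u01 n z).
Qed.

Lemma sigma_avg k x : sigma_state (fun f => avg k P f x).
Proof.
move=> u u01 u0.
suff h : (\sum_(1 <= i < k.+1) iter i P (u n) x : R) @[n --> \oo] --> (0 : R).
  have : k%:R^-1 * \sum_(1 <= i < k.+1) iter i P (u n) x @[n --> \oo] -->
      k%:R^-1 * (0 : R) by apply: cvgM => //; exact: cvg_cst.
  rewrite mulr0.
  apply: cvg_trans; apply: near_eq_cvg; apply: nearW => n.
  by rewrite avgE.
elim: (index_iota _ _) => [|i r IH].
  by under eq_cvg do rewrite big_nil; exact: cvg_cst.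
under eq_cvg do rewrite big_cons.
have : iter i P (u n) x + \sum_(j <- r) iter j P (u n) x @[n --> \oo] -->
    (0 : R) + 0 by apply: cvgD => //; exact: (@sigma_iter i x u).
by rewrite addr0.
Qed.

Lemma nonincr_cvg (E : nat -> set X) (F : V -> R) : sigma_state F ->
  (forall i, measurable (E i)) -> (forall i j, (i <= j)%N -> E j `<=` E i) ->
  (forall x, exists i, ~ E i x) -> F (indb R (E n)) @[n --> \oo] --> (0 : R).
Proof.
move=> sF mE dE E0; apply: sF => [n x|x].
  by rewrite indbE //; case: (_ \in _); rewrite ?lexx ?ler01.
have [i Eix] := E0 x; apply: cvg_near_cst; exists i => // n /= i_n.
by rewrite indbE // memNset // => /(dE _ _ i_n).
Qed.

(* A gliding hump: otherwise [M] keeps a positive mass [L] on the decreasing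
   sets; two disjoint unions of their layers, each of [M]-mass close to [L],
   then fit in a set of [M]-mass close to [L]. *)
Lemma invariant_nonincr (E : nat -> set X) e :
  (forall i, measurable (E i)) -> (forall i j, (i <= j)%N -> E j `<=` E i) ->
  (forall x, exists i, ~ E i x) -> 0 < e -> exists i, M (indb R (E i)) < e.
Proof.
move=> mE dE E0 e0; apply: contrapT => /forallNP H.
have {}H i : e <= M (indb R (E i)) by rewrite leNgt; apply/negP/H.
have [x0 _] : exists x0 : X, True.
  apply: contrapT => /forallNP X0; have := state_one sM.
  rewrite (_ : oneb = 0) ?(state0 sM); first by move/esym/eqP; rewrite oner_eq0.
  by apply: bmfunP => x; case: (X0 x).
pose A := range (fun i => M (indb R (E i))); pose L := inf A.
have lA : lbound A e by move=> _ [i _ <-].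
have hA : has_inf A by split; [exists (M (indb R (E 0))), 0 | exists e].
have L0 : 0 < L by apply: lt_le_trans e0 _; apply: lb_le_inf => //; case: hA.
have AL i : L <= M (indb R (E i)) by apply: ge_inf; [case: hA|exists i].
have [j0 Hj0] : exists j0, M (indb R (E j0)) < L + L / 10.
  have L10 : 0 < L / 10 by lra.
  have [_ [j _ <-] Hj] := inf_adherent L10 hA.
  by exists j.
(* The means at the single point [x0] are countably additive and converge to [M] on each set. *)
pose nu n f := avg n.+1 P f x0.
have snu n : state (nu n) by exact: markov_avg.
have nuM D c : measurable D -> 0 < c ->
    exists N, forall n, (N <= n)%N -> `|nu n (indb R D) - M (indb R D)| <= c.
  move=> mD c0; have [N HN] := avg_cvg (indb R D) c0.
  by exists N => n Nn; apply: HN; exact: leq_trans Nn _.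
have mB i j : measurable (E i `\` E j) by exact: measurableD.
(* Given a set index [j] and a time bound [i], some [nu n] with [n >= i] gives [E j] at least
   [9/10 L]; being countably additive, it gives a later [E j'] at most [L/10]. The layer between
   them keeps [8/10 L]. *)
have /choice[phi Hphi] (ji : nat * nat) : exists jn : nat * nat,
    [/\ (ji.1 < jn.1)%N, (ji.2 <= jn.2)%N &
        8 / 10 * L <= nu jn.2 (indb R (E ji.1 `\` E jn.1))].
  case: ji => j i /=; have L10 : 0 < L / 10 by lra.
  have [N HN] := nuM _ _ (mE j) L10.
  have := nonincr_cvg (@sigma_avg (maxn N i).+1 x0) mE dE E0.
  move/cvgrPdist_le => /(_ _ L10)[K _ HK].
  pose j' := maxn j.+1 K; exists (j', maxn N i); split=> /=.
  - exact: leq_maxl.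
  - exact: leq_maxr.
  have h1 : `|nu (maxn N i) (indb R (E j'))| <= L / 10.
    by have := HK j' (leq_maxr _ _); rewrite /= sub0r normrN.
  have := HN (maxn N i) (leq_maxl _ _) => h2.
  have jj' : (j <= j')%N by exact: leq_trans (leqnSn _) (leq_maxl _ _).
  have := state_indbU_le (snu (maxn N i)) (mB j j') (mE j').
  rewrite (setUC (_ `\` _)) setDUK; last exact: dE.
  move: h1 h2 (AL j); rewrite !ler_norml; clear.
  move: (nu _ _) (nu _ _) (nu _ _) (M _) => a1 a2 a3 a4 /andP[? ?] /andP[? ?]; lra.
pose J := fix J i := if i is k.+1 then (phi (J k, k)).1 else j0.
pose B i := E (J i) `\` E (J i.+1).
have Jmono : {homo J : i j / (i <= j)%N}.
  apply: homo_leq => //; first exact: leq_trans.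
  by move=> i; apply: ltnW; have [] := Hphi (J i, i).
have Bdisj i j : (i < j)%N -> B i `&` B j = set0.
  by move=> ij; rewrite -subset0 => x [[_ nE] [/(dE _ _ (Jmono _ _ ij))]].
have BE i : B i `<=` E j0.
  by move=> x [Ex _]; apply: dE (Jmono _ _ (leq0n i)) _ Ex.
(* The union contains [B (s N)], to which some [nu n] with [n >= N] gives [8/10 L]; for such [n],
   [nu n] and [M] differ by at most [L/10] on the union. *)
have massive (s : nat -> nat) : (forall i, (i <= s i)%N) ->
    7 / 10 * L <= M (indb R (\bigcup_i B (s i))).
  move=> si; have mU : measurable (\bigcup_i B (s i)).
    by apply: bigcup_measurable => i _; exact: mB.
  have L10 : 0 < L / 10 by lra.
  have [N HN] := nuM _ _ mU L10.
  have [_ + h2] := Hphi (J (s N), s N); set n := (phi _).2 => /= h1.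
  have := HN n (leq_trans (si N) h1); rewrite ler_norml => /andP[_ h3].
  have : nu n (indb R (B (s N))) <= nu n (indb R (\bigcup_i B (s i))).
    by apply: state_indb_le => //; [exact: mB|by move=> y By; exists N].
  move: h2 h3; rewrite -/(J (s N).+1) /= -/n -/(B _); clear.
  move: (nu _ _) (nu _ _) (M _) => a b c; lra.
(* The even and the odd layers have disjoint unions inside [E j0], which would then have mass at
   least [14/10 L], whereas [j0] was chosen with mass below [11/10 L]. *)
have h1 := massive (fun i => i.*2) (fun i => leq_trans (leq_addr _ _) (eq_leq (addnn i))).
have h2 : 7 / 10 * L <= M (indb R (\bigcup_i B i.*2.+1)).
  by apply: massive => i; rewrite -addnn -addnS leq_addr.
have mF : measurable (\bigcup_i B i.*2) by apply: bigcup_measurable => i _; exact: mB.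
have mG : measurable (\bigcup_i B i.*2.+1) by apply: bigcup_measurable => i _; exact: mB.
have FG : (\bigcup_i B i.*2) `&` (\bigcup_i B i.*2.+1) = set0.
  rewrite -subset0 => x [[i _ Bi] [j _ Bj]].
  have [ij|ji|ij] := ltngtP i.*2 j.*2.+1.
  - by rewrite -(Bdisj _ _ ij).
  - by rewrite -(Bdisj _ _ ji).
  - by have := congr1 odd ij; rewrite /= !odd_double.
have : M (indb R ((\bigcup_i B i.*2) `|` (\bigcup_i B i.*2.+1))) <= M (indb R (E j0)).
  apply: state_indb_le => //; first exact: measurableU.
  by move=> x [[i _ /BE]|[i _ /BE]].
rewrite (state_indbU sM) //; lra.
Qed.

(** Countable subadditivity: what the first [n] sets leave of the union decreases to the empty set,
    so [invariant_nonincr] makes its mass arbitrarily small. *)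
Lemma invariant_bigcup_le (E : nat -> set X) (u : nat -> R) c :
  (forall i, measurable (E i)) -> (forall i, M (indb R (E i)) <= u i) ->
  (forall n, \sum_(i < n) u i <= c) -> M (indb R (\bigcup_i E i)) <= c.
Proof.
move=> mE Eu uc; apply/ler_addgt0Pl => e e0.
pose D n := (\bigcup_i E i) `\` \big[setU/set0]_(i < n) E i.
have mU : measurable (\bigcup_i E i) by exact: bigcup_measurable.
have mUn n : measurable (\big[setU/set0]_(i < n) E i) by exact: bigsetU_measurable.
have mD n : measurable (D n) by exact: measurableD.
have [||n Hn] := @invariant_nonincr D e mD _ _ e0.
- move=> i j ij x [Ux nUj]; split=> //; apply: contra_not nUj.
  by rewrite -!bigcup_mkord => -[k /= ki Ekx]; exists k => //=; exact: leq_trans ij.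
- move=> x; have [[i _ Eix]|nEx] := pselect ((\bigcup_i E i) x); last by exists 0 => -[].
  by exists i.+1 => -[_]; apply; rewrite -bigcup_mkord; exists i => /=.
have := state_indbU_le sM (mD n) (mUn n); rewrite (setUC (D n)) setDUK; last first.
  by rewrite -bigcup_mkord => x [i _ Eix]; exists i.
move/le_trans; apply; rewrite lerD ?(ltW Hn) //.
apply: le_trans (state_indb_bigU sM _ mE) (le_trans _ (uc n)).
exact: ler_sum.
Qed.

(** Doeblin's condition. Otherwise there are sets [E_k] of mass below [2^-(k+1)] with means of order
    at least [k] above [e]. For large [m] the union of the [E_k], [k >= m], has mass at most [e/4];
    convergence of the means on this single set keeps them below [e]. *)
Lemma avg_uniform_continuity e : 0 < e ->
  exists2 r, 0 < r & exists N, forall E, measurable E -> M (indb R E) < r ->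
    forall n, (N <= n)%N -> forall x, avg n P (indb R E) x <= e.
Proof.
move=> e0; apply: contrapT => H.
have /choice[enx Hk] (k : nat) : exists enx : set X * nat * X,
    [/\ measurable enx.1.1, M (indb R enx.1.1) < 2^-1 ^+ k.+1, (k <= enx.1.2)%N &
        e < avg enx.1.2 P (indb R enx.1.1) enx.2].
  apply: contrapT => Hk; apply: H; exists (2^-1 ^+ k.+1); first by rewrite exprn_gt0.
  exists k => E mE ME n kn x; rewrite leNgt; apply/negP => ex; apply: Hk.
  by exists (E, n, x).
pose E m i := (enx (m + i)%N).1.1.
have mE m i : measurable (E m i) by case: (Hk (m + i)%N).
have mF m : measurable (\bigcup_i E m i) by exact: bigcup_measurable.
have geo m n : \sum_(i < n) (2^-1 : R) ^+ (m + i).+1 = 2^-1 ^+ m - 2^-1 ^+ (m + n).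
  elim: n => [|n IH]; first by rewrite big_ord0 addn0 subrr.
  by rewrite big_ord_recr /= IH addnS exprS; lra.
have MF m : M (indb R (\bigcup_i E m i)) <= 2^-1 ^+ m.
  apply: (invariant_bigcup_le (u := fun i => 2^-1 ^+ (m + i).+1)) => // [i|n].
    by apply: ltW; case: (Hk (m + i)%N).
  by rewrite geo gerBl exprn_ge0.
have [m Hm] : exists m, (2^-1 : R) ^+ m <= e / 4.
  have : (2^-1 : R) ^+ n @[n --> \oo] --> (0 : R).
    by apply: cvg_expr; rewrite ger0_norm ?invr_ge0 // invf_lt1 // ltr1n.
  move/cvgrPdist_le => /(_ (e / 4))[|m _ Hm]; first by lra.
  exists m; have := Hm m (leqnn m); rewrite /= sub0r normrN.
  exact: le_trans (ler_norm _).
have [|N HN] := avg_cvg (indb R (\bigcup_i E m i)) (e := e / 4); first by lra.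
pose k := (m + N)%N; have [_ _ kn] := Hk k.
have := HN (enx k).1.2 (leq_trans (leq_addl _ _) kn) (enx k).2.
have n0 : (0 < (enx k).1.2.+1)%N by [].
have [n00|nn0] := posnP (enx k).1.2.
  by move=> _; rewrite n00 avgE invr0 mul0r ltNge (ltW e0).
rewrite ler_norml => /andP[_ h1] h2.
have := state_indb_le (markov_avg nn0 mP (enx k).2) (mE m N) (mF m).
have EF : E m N `<=` \bigcup_i E m i by move=> y Ey; exists N.
move/(_ EF); move: h1 h2 (MF m) Hm e0; rewrite /E -/k; clear.
move: (avg _ _ _ _) (avg _ _ _ _) (M _) => a b c; lra.
Qed.

End UniqueInvariantState.

(** * Almost invariant functions and uniform convergence of the means *)

Section UniformErgodicity.
Context d (X : measurableType d) (R : realType).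
Local Notation V := (bmfun X R).
Implicit Types (f g h : V) (E : set X).

Variables (P : V -> V) (M : V -> R).
Hypotheses (mP : markov P) (iM : invariant_state P M).
Hypothesis uniqM : forall G, invariant_state P G -> forall f, G f = M f.
Hypothesis sigmaP : forall x, sigma_state (fun f => P f x).

Let sM : state M. Proof. by case: iM. Qed.

Definition almost_invariant n h := (forall y, `|h y| <= 1) /\
  forall y, `|(P h - h) y| <= n.+1%:R^-1.

Lemma almost_invariantN n h : almost_invariant n h -> almost_invariant n (- h).
Proof.
move=> [h1 hn]; split=> y; first by rewrite bmfun_opp normrN.
by rewrite (markovN mP) -opprD bmfun_opp normrN.
Qed.

Lemma almost_invariant_le m n h : (m <= n)%N -> almost_invariant n h ->
  almost_invariant m h.
Proof.
move=> mn [h1 hn]; split=> // y; rewrite (le_trans (hn y)) //.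
by rewrite lef_pV2 ?posrE ?ltr0n // ler_nat.
Qed.

Lemma almost_invariant_mid n g h : almost_invariant n g -> almost_invariant n h ->
  almost_invariant n (2^-1 *: (g + h)).
Proof.
move=> [g1 gn] [h1 hn].
have mid (u v : V) c : (forall y, `|u y| <= c) -> (forall y, `|v y| <= c) ->
    forall y, `|(2^-1 *: (u + v)) y| <= c.
  move=> uc vc y; rewrite !bmfunE normrM ger0_norm ?invr_ge0 //.
  by have := ler_normD (u y) (v y); have := uc y; have := vc y; lra.
split; first exact: mid.
rewrite (markovZ mP) (markovD mP) -scalerBr opprD addrACA; exact: mid.
Qed.

(* Near-minimizers of the convex functional [h |-> M (h ^ 2)] over a decreasing
   sequence of convex sets are close to one another in [L^2 (M)], by the
   parallelogram identity. *)
Lemma convex_near_minimizers (C : nat -> set V) r : 0 < r ->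
  (forall n, C n !=set0) -> (forall m n, (m <= n)%N -> C n `<=` C m) ->
  (forall n g h, C n g -> C n h -> C n (2^-1 *: (g + h))) ->
  (forall n h, C n h -> forall y, `|h y| <= 1) ->
  exists n0 g0, C n0 g0 /\ forall n, (n0 <= n)%N ->
    exists2 g, C n g & M (sqb (g - g0)) <= r.
Proof.
move=> r0 C0 dC midC C1; pose J h := M (sqb h).
have J01 n h : C n h -> 0 <= J h <= 1.
  move=> Ch; rewrite (state_ge_cst sM) ?(state_le_cst sM) // => y; rewrite sqbE.
    by rewrite -[leRHS](expr1n _ 2) -real_normK ?num_real // lerXn2r ?nnegrE // (C1 n).
  exact: sqr_ge0.
pose s n := inf (J @` C n).
have hI n : has_inf (J @` C n).
  split; first by have [h Ch] := C0 n; exists (J h), h.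
  by exists 0 => _ [h Ch <-]; have /andP[] := J01 _ _ Ch.
have hS : has_sup (range s).
  split; first by exists (s 0), 0.
  exists 1 => _ [n _ <-]; have [h Ch] := C0 n; have /andP[_ h1] := J01 _ _ Ch.
  by apply: le_trans h1; apply: ge_inf; [case: (hI n)|exists h].
pose S := sup (range s).
have sS n : s n <= S by apply: sup_ubound; [case: hS|exists n].
have r8 : 0 < r / 8 by lra.
have [_ [n0 _ <-] Hn0] := sup_adherent r8 hS.
have near_min n : exists2 g, C n g & J g < S + r / 8.
  have [_ [g Cg <-] Hg] := inf_adherent r8 (hI n).
  by exists g => //; apply: lt_le_trans Hg _; rewrite lerD2r; exact: sS.
have [g0 Cg0 Jg0] := near_min n0.
exists n0, g0; split=> // n n0n; have [g Cg Jg] := near_min n; exists g => //.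
have Cm := midC _ _ _ (dC _ _ n0n _ Cg) Cg0.
have Jm : S - r / 8 < J (2^-1 *: (g + g0)).
  by apply: lt_le_trans Hn0 _; apply: ge_inf; [case: (hI n0)|exists (2^-1 *: (g + g0))].
have par : sqb (g - g0) = 2 *: sqb g + 2 *: sqb g0 - 4 *: sqb (2^-1 *: (g + g0)).
  by apply: bmfunP => y; rewrite !bmfunE !sqbE !bmfunE; field.
rewrite par (stateB sM) (stateD sM) !(stateZ sM) -/(J _) -/(J _) -/(J _).
move: Jg Jg0 Jm; clear; rewrite /S; move: (J _) (J _) (J _) (sup _) => a b c t; lra.
Qed.

Lemma almost_invariant_pointwise x (c : R) : 0 < c ->
  exists N, forall h, almost_invariant N h -> h x - M h < c.
Proof.
move=> c0; apply: contrapT => /forallNP H.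
pose C n : set V := [set h | almost_invariant n h /\ c <= h x - M h].
pose e := c / 9; have e0 : 0 < e by rewrite /e; lra.
have [r0 r00 [N HN]] := avg_uniform_continuity mP iM uniqM sigmaP e0.
(* By Chebyshev's inequality, [M ((g - g0) ^ 2) <= r] gives the set where [|g - g0| > e] mass at
   most [r0/2]. *)
pose r := r0 / 2 * e ^+ 2.
have rpos : 0 < r by rewrite /r mulr_gt0 ?exprn_gt0 // divr_gt0.
have [||||n0 [g0 [[Cg0 _] Hg0]]] := @convex_near_minimizers C r rpos.
- move=> n; have /existsNP[h /not_implyP[hn hx]] := H n.
  by exists h; split=> //; rewrite leNgt; apply/negP.
- by move=> m n mn h [hn hc]; split=> //; exact: almost_invariant_le hn.
- move=> n g h [gn gc] [hn hc]; split; first exact: almost_invariant_mid.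
  rewrite (stateZ sM) (stateD sM) !bmfunE; move: gc hc; clear.
  by move: (g x) (h x) (M g) (M h) => a b a' b'; lra.
- by move=> n h [[h1 _] _].
have [N2 HN2] := avg_cvg mP iM uniqM g0 e0.
(* The order [m] is fixed from [g0] before [g] is chosen; [g] can then be so nearly invariant that
   [avg m P] moves it by at most [e]. *)
pose m := maxn 1 (maxn N N2).
have m0 : (0 < m)%N by exact: leq_maxl.
have mN : (N <= m)%N by rewrite !leq_max leqnn orbT.
have mN2 : (N2 <= m)%N by rewrite !leq_max leqnn !orbT.
have [K HK] := small_div (ler0n R m) e0.
have [g [[g1 gn] gc] Mg] := Hg0 (maxn n0 K) (leq_maxl _ _).
pose E := [set y | e < absb (g - g0) y].
have mE : measurable E by exact: measurable_bmfun_gt.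
have ME : M (indb R E) < r0.
  have := state_markov_ineq sM (f := sqb (g - g0)) (e := e ^+ 2) (c := 0) mE.
  rewrite addr0 => /(_ _)/le_trans-/(_ _ _ Mg) ME.
  have : e ^+ 2 * M (indb R E) <= r0 / 2 * e ^+ 2.
    apply: ME => y; rewrite addr0; have [|_] := boolP (y \in E); last first.
      by rewrite mulr0 sqbE sqr_ge0.
    rewrite inE /E /= absbE mulr1 sqbE => ey.
    rewrite -[leRHS]real_normK ?num_real // ler_sqr ?nnegrE //; exact: ltW.
  by rewrite mulrC ler_pM2r ?exprn_gt0 // => /le_lt_trans; apply; lra.
have avgE y : avg m P (indb R E) y <= e by exact: HN.
have ME' : M (indb R E) <= e by rewrite -(invariant_avg iM _ m0); apply: state_le_cst.
have diff u : u = g - g0 \/ u = g0 - g -> forall y, u y <= e + 2 * (y \in E)%:R.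
  move=> ug y; have uy : u y <= `|(g - g0) y|.
    by case: ug => ->; rewrite ?ler_norm // -[g0 - g]opprB bmfun_opp -normrN ler_norm.
  have [yE|] := boolP (y \in E).
    rewrite mulr1; have := ler_normB (g y) (g0 y); have := g1 y; have [+ _] := Cg0.
    move/(_ y); move: uy e0; rewrite !bmfunE; clear.
    by lra.
  by rewrite notin_setE /E /= absbE mulr0 addr0 => /negP; rewrite -leNgt; exact: le_trans.
have a1 := state_le_indb (markov_avg m0 mP x) mE (diff _ (or_introl erefl)).
have a2 := state_le_indb sM mE (diff _ (or_intror erefl)).
have a3 := HN2 m mN2 x.
have a4 : `|(avg m P g - g) x| <= e.
  apply: le_trans (avg_drift m0 mP gn x) _; apply: HK; exact: leq_maxr.
(* [g x - M g] is at most [e + 3e + e + 3e = 8e < c]: drift of [g], replacing [g] by [g0] in the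
   mean, convergence for [g0], replacing [g0] by [g] in [M]. *)
move: a1 a2 a3 a4 gc (avgE x) ME'.
rewrite (markovB (markov_avg m0 mP)) (stateB sM) !bmfunE !ler_norml.
have : c = 9 * e by rewrite /e; lra.
move: e0; clear.
move: (avg m P g x) (avg m P g0 x) (avg m P (indb R E) x) (M g) (M g0).
move: (M (indb R E)) (g x).
move=> b1 b2 b3 b4 b5 b6 b7 ? ? ? ? /andP[? ?] /andP[? ?]; lra.
Qed.

Lemma almost_invariant_uniform (e : R) : 0 < e ->
  exists N, forall h, almost_invariant N h -> forall x, `|h x - M h| <= e.
Proof.
move=> e0; apply: contrapT => /forallNP H.
have /choice[h Hh] n : exists h, almost_invariant n h /\ exists x, e < `|h x - M h|.
  have /existsNP[h /not_implyP[hn /existsNP[x hx]]] := H n.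
  by exists h; split=> //; exists x; rewrite ltNge; apply/negP.
pose t := e / 5; have t0 : 0 < t by rewrite /t; lra.
have [r0 r00 [N' HN']] := avg_uniform_continuity mP iM uniqM sigmaP t0.
pose N := maxn 1 N'; have N0 : (0 < N)%N by exact: leq_maxl.
(* By the pointwise result for [h n] and [- h n], each point is outside [F n] for all large [n]; so
   the tails [G m] decrease to the empty set and their masses become small. *)
pose F n := [set y | t < absb (h n - M (h n) *: oneb) y].
have mF n : measurable (F n) by exact: measurable_bmfun_gt.
have FE n y : F n y -> t < `|h n y - M (h n)|.
  by rewrite /F /= absbE !bmfunE mulr1.
pose G m := \bigcup_(n >= m) F n.
have mG m : measurable (G m) by exact: bigcup_measurable.
have [||m Hm] := invariant_nonincr mP iM uniqM sigmaP mG _ _ r00.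
- by move=> i j ij y [n /= jn Fn]; exists n => //=; exact: leq_trans jn.
- move=> y; have [N1 HN1] := almost_invariant_pointwise y t0.
  exists N1 => -[n /= N1n /FE].
  have hn := almost_invariant_le N1n (proj1 (Hh n)).
  have := HN1 _ hn; have := HN1 _ (almost_invariantN hn).
  rewrite (stateN sM) bmfun_opp; clear; move: (h n y) (M (h n)) => a b ab ba.
  by apply/negP; rewrite -leNgt ler_norml; apply/andP; split; lra.
have [K HK] := small_div (ler0n R N) t0.
pose n := maxn m K.
have Fr0 : M (indb R (F n)) < r0.
  apply: le_lt_trans Hm; apply: state_indb_le => // y Fy; exists n => //=.
  exact: leq_maxl.
have avgF y : avg N P (indb R (F n)) y <= t by apply: HN' => //; exact: leq_maxr.
have [[h1 hn] [x hx]] := Hh n.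
(* Stated for [u] to serve both [h n] and [- h n]. The drift costs [t], the part off [F n] another
   [t], and [F n] itself at most [2 t]; the total is below [e = 5 t]. *)
have bound (u : V) : (forall y, `|u y| <= 1) ->
    (forall y, `|u y - M u| = `|h n y - M (h n)|) ->
    (forall y, `|(P u - u) y| <= n.+1%:R^-1) -> u x - M u <= 4 * t.
  move=> u1 uh uinv.
  have u2 y : (u - M u *: oneb) y <= t + 2 * (y \in F n)%:R.
    rewrite !bmfunE mulr1; have [_|] := boolP (y \in F n).
      rewrite mulr1 (le_trans (ler_norm _)) // (le_trans (ler_normB _ _)) //.
      by have := u1 y; have := state_norm_le sM u1; lra.
    rewrite notin_setE /F /= absbE !bmfunE mulr1 -uh mulr0 addr0 => /negP.
    by rewrite -leNgt; exact: le_trans (ler_norm _).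
  have := state_le_indb (markov_avg N0 mP x) (mF n) u2.
  rewrite (markovB (markov_avg N0 mP)) (markovZ (markov_avg N0 mP)).
  rewrite (markov_one (markov_avg N0 mP)) !bmfunE mulr1.
  have : `|(avg N P u - u) x| <= t.
    by apply: le_trans (avg_drift N0 mP uinv x) _; apply: HK; exact: leq_maxr.
  rewrite !bmfunE ler_norml; move: (avgF x); clear.
  by move: (avg N P u x) (avg N P (indb R (F n)) x) (M u) (u x) => a b c w ? /andP[? ?] ?; lra.
have b1 : h n x - M (h n) <= 4 * t by exact: bound.
have [hN1 hNn] := almost_invariantN (proj1 (Hh n)).
have b2 : (- h n) x - M (- h n) <= 4 * t.
  apply: bound => // y.
  by rewrite bmfun_opp (stateN sM) -opprD normrN.
move: hx b1 b2 e0; rewrite (stateN sM) bmfun_opp /t ltNge ler_norml; clear.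
move: (h n x) (M (h n)) => a b + ? ? ?; apply/negP; rewrite negbK.
by apply/andP; split; lra.
Qed.

(** [avg n P f] is itself almost invariant, with defect at most [2/n], and [M] takes the same value
    on it as on [f]; hence a rate independent of [f]. *)
Theorem avg_uniform_cvg (e : R) : 0 < e ->
  exists N, forall n, (N <= n)%N -> forall f, (forall y, `|f y| <= 1) ->
    forall x, `|avg n P f x - M f| <= e.
Proof.
move=> e0; have [N HN] := almost_invariant_uniform e0.
exists (2 * N.+1)%N => n Nn f f1 x; have n0 : (0 < n)%N by exact: leq_trans Nn.
rewrite -(invariant_avg iM f n0); apply: HN; split=> y.
  exact: (state_norm_le (markov_avg n0 mP y)).
apply: le_trans (avg_defect n mP f1 y) _.
rewrite mulr1 ler_pdivrMr ?ltr0n // mulrC ler_pdivlMr ?ltr0n //.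
by rewrite -natrM ler_nat.
Qed.

End UniformErgodicity.

(** * Powers of a Markov operator without cycles *)

Section UniformMixing.
Context d (X : measurableType d) (R : realType).
Local Notation V := (bmfun X R).
Implicit Types (f g h : V) (E : set X).

Lemma avg_le_cst (P : V -> V) n f x c : (0 < n)%N ->
  (forall k, (0 < k <= n)%N -> iter k P f x <= c) -> avg n P f x <= c.
Proof.
move=> n0 fc; rewrite avgE mulrC ler_pdivrMr ?ltr0n // mulrC -sum_cst_nat.
exact: ler_sum_nat.
Qed.

Lemma avg_ge_cst (P : V -> V) n f x c : (0 < n)%N ->
  (forall k, (0 < k <= n)%N -> c <= iter k P f x) -> c <= avg n P f x.
Proof.
move=> n0 fc; rewrite avgE mulrC ler_pdivlMr ?ltr0n // mulrC -sum_cst_nat.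
exact: ler_sum_nat.
Qed.

Variables (P : V -> V) (M : V -> R).
Hypotheses (mP : markov P) (iM : invariant_state P M).
Hypothesis sigmaP : forall x, sigma_state (fun f => P f x).
Hypothesis uniqM : forall r, (0 < r)%N ->
  forall G, invariant_state (iter r P) G -> forall f, G f = M f.

Let sM : state M. Proof. by case: iM. Qed.

Definition lazy r f : V := locked (2^-1 *: (f + iter r P f)).

Lemma lazyE r f x : lazy r f x = 2^-1 * (f x + iter r P f x).
Proof. by rewrite /lazy -lock !bmfunE. Qed.

Lemma markov_lazy r : markov (lazy r).
Proof.
move=> x; have mr := markov_pow r mP x.
split=> [a f g|f f0|]; rewrite !lazyE.
- by rewrite (stateD mr) (stateZ mr) !bmfunE; lra.
- by rewrite mulr_ge0 ?invr_ge0 // addr_ge0 //; have [_ + _] := mr; apply.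
- by rewrite (state_one mr) bmfunE; lra.
Qed.

Lemma lazy_iter r k f : lazy r (iter k P f) = iter k P (lazy r f).
Proof.
apply: bmfunP => x; rewrite lazyE /lazy -lock.
rewrite (markovZ (markov_pow k mP)) (markovD (markov_pow k mP)) !bmfunE.
by rewrite -!iterD addnC.
Qed.

Lemma lazy_comm r s f : lazy r (lazy s f) = lazy s (lazy r f).
Proof.
apply: bmfunP => x; rewrite !lazyE -!lazy_iter !lazyE -!iterD addnC; lra.
Qed.

Lemma invariant_lazy r f : M (lazy r f) = M f.
Proof. by rewrite /lazy -lock (stateZ sM) (stateD sM) (invariant_iter iM); lra. Qed.

(* If [P^(2N) g x] is nearly [1], then from [x] the chain is after [k <= 2N]
   steps nearly surely in the set where [P^(2N-k) g] is nearly [1].  When no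
   [lazy r g] comes near [1], these sets for [k <= N] are disjoint from those
   for [k > N], although both families of times visit their union equally. *)
Lemma overlap : exists2 N, (0 < N)%N & forall g b, (forall y, `|g y| <= 1) ->
  (forall r, (0 < r < N.*2)%N -> forall y, `|lazy r g y| <= b) ->
  forall x, `|iter N.*2 P g x| <= 1 - (1 - b) / 4.
Proof.
(* Two errors of [1/5] cannot bridge the gap between [3/4] and [1/4] found below. *)
have e5 : (0 : R) < 1 / 5 by lra.
have [N' HN'] := avg_uniform_cvg mP iM (uniqM (r := 1) erefl) sigmaP e5.
pose N := maxn 1 N'; have N0 : (0 < N)%N by exact: leq_maxl.
exists N => //.
suff upper g b : (forall y, g y <= 1) ->
    (forall r, (0 < r < N.*2)%N -> forall y, lazy r g y <= b) ->
    forall x, iter N.*2 P g x <= 1 - (1 - b) / 4.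
  move=> g b g1 gb x; rewrite ler_norml; apply/andP; split; last first.
    apply: upper => [y|r rN y]; first by rewrite (le_trans (ler_norm _)).
    by rewrite (le_trans (ler_norm _)) ?gb.
  rewrite lerNl -bmfun_opp -(markovN (markov_pow _ mP)).
  apply: upper => [y|r rN y].
    by rewrite bmfun_opp (le_trans (ler_norm _)) ?normrN.
  by rewrite (markovN (markov_lazy r)) bmfun_opp (le_trans (ler_norm _)) ?normrN ?gb.
move=> g1 gb x; rewrite leNgt; apply/negP => gx.
have iter1 k y : iter k P g y <= 1 by exact: (state_le_cst (markov_pow k mP y)).
have b1 : b < 1.
  by move: (iter1 N.*2 x) gx; clear; move: (iter N.*2 P g x) => a; lra.
pose u k := iter (N.*2 - k) P g.
pose U k := [set y | b < u k y].
have mU k : measurable (U k) by exact: measurable_bmfun_gt.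
(* [P^k (u k) = P^(2N) g] exceeds [1 - (1 - b)/4] at [x], while [u k] is at most [b] off [U k] and
   at most [1] on it. *)
have PU k : (k <= N.*2)%N -> 3 / 4 <= iter k P (indb R (U k)) x.
  move=> kN; have uU y : u k y <= b + (1 - b) * (y \in U k)%:R.
    have [_|] := boolP (y \in U k).
      by rewrite mulr1 addrC subrK; exact: iter1.
    by rewrite mulr0 addr0 notin_setE => /negP; rewrite -leNgt.
  have := state_le_indb (markov_pow k mP x) (mU k) uU.
  rewrite /u -iterD subnKC //; move: gx b1; clear.
  move: (iter k P (indb R (U k)) x) => q h1 h2; move: (iter N.*2 P g x) h1 h2 => p h1 h2 h3.
  have : (1 - b) * (3 / 4) <= (1 - b) * q by lra.
  by rewrite ler_pM2l // subr_gt0.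
pose F := \big[setU/set0]_(k < N) U k.+1.
have mF : measurable F by exact: bigsetU_measurable.
have FP y : F y -> exists2 k, (0 < k <= N)%N & U k y.
  by rewrite /F -(bigcup_mkord N (fun k => U k.+1)) => -[k /= kN Uk]; exists k.+1.
have UF k : (0 < k <= N)%N -> U k `<=` F.
  case: k => // k kN y Uy; rewrite /F -(bigcup_mkord N (fun k => U k.+1)).
  by exists k.
(* At a common point of [U k] and [U l], both [u l] and [u k = P^(l-k) (u l)] exceed [b], but their
   half-sum is [P^(2N-l) (lazy (l-k) g) <= b]. *)
have FU l : (N < l <= N.*2)%N -> F `&` U l = set0.
  move=> /andP[Nl lN]; rewrite -subset0 => y [/FP[k /andP[k0 kN] Uk] Ul].
  have kl : (k <= l)%N by exact: leq_trans kN (ltnW Nl).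
  have r0 : (0 < l - k < N.*2)%N.
    rewrite subn_gt0 (leq_ltn_trans kN Nl) /= (leq_trans _ lN) //.
    by rewrite ltn_subrL k0 (leq_trans k0 kl).
  have : lazy (l - k) (u l) y <= b.
    rewrite /u lazy_iter (state_le_cst (markov_pow _ mP y)) // => z.
    exact: gb.
  rewrite lazyE {2}/u -iterD.
  have -> : (l - k + (N.*2 - l) = N.*2 - k)%N by lia.
  by move: Uk Ul; rewrite /U /= -/(u k); move: (u k y) (u l y) => p q; lra.
have F1 (k : nat) y : `|iter k P (indb R F) y| <= 1.
  apply: (state_norm_le (markov_pow k mP y)) => z.
  by rewrite indbE //; case: (_ \in _); rewrite ?normr1 ?normr0.
have h1 : 3 / 4 <= avg N P (indb R F) x.
  apply: avg_ge_cst => // k /andP[k0 kN].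
  apply: le_trans (PU k _) (state_indb_le (markov_pow k mP x) _ _ _) => //.
    by rewrite (leq_trans kN) // -addnn leq_addr.
  by apply: UF; rewrite k0.
have h2 : avg N P (iter N P (indb R F)) x <= 1 / 4.
  apply: avg_le_cst => // k /andP[k0 kN]; rewrite -iterD.
  have kN2 : (N < k + N <= N.*2)%N by rewrite -addnn leq_add2r kN -addn1 addnC leq_add2r k0.
  have := state_indbU (markov_pow (k + N) mP x) mF (mU (k + N)%N) (FU _ kN2).
  have : iter (k + N) P (indb R (F `|` U (k + N)%N)) x <= 1.
    apply: (state_le_cst (markov_pow _ mP x)) => z.
    by rewrite indbE ?lern1 ?leq_b1 //; exact: measurableU.
  have := PU (k + N)%N; case/andP: kN2 => _ -> /(_ isT).
  clear; lra.
have := HN' N (leq_maxr _ _) _ (F1 0) x.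
have := HN' N (leq_maxr _ _) _ (F1 N) x.
rewrite (invariant_iter iM) !ler_norml; move: h1 h2; clear => /=.
by move=> ? ? /andP[? ?] /andP[? ?]; lra.
Qed.

(** If a half-sum of two numbers at most [1] is within [c] of [1], both are within [2 c]. Each of
    the [m] lazy steps costs this factor [2], whichever term is followed. *)
Lemma lazy_close r m f x c : (forall y, f y <= 1) ->
  1 - c <= iter m (lazy r) f x ->
  forall j, (j <= m)%N -> 1 - 2 ^+ m * c <= iter j (iter r P) f x.
Proof.
have le1 k g y : (forall z, g z <= 1) -> iter k (lazy r) g y <= 1.
  by move=> g1; exact: (state_le_cst (markov_pow k (markov_lazy r) y)).
elim: m f c => [|m IH] f c f1; first by move=> fx [|//] _; rewrite mul1r.
have Pf1 y : iter r P f y <= 1 by exact: (state_le_cst (markov_pow r mP y)).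
rewrite iterSr /lazy -lock (markovZ (markov_pow m (markov_lazy r))).
rewrite (markovD (markov_pow m (markov_lazy r))) !bmfunE => fx.
have h1 : 1 - 2 * c <= iter m (lazy r) f x.
  by move: fx (le1 m _ x Pf1); clear; lra.
have h2 : 1 - 2 * c <= iter m (lazy r) (iter r P f) x.
  by move: fx (le1 m _ x f1); clear; lra.
rewrite exprSr -mulrA => -[|j] jm; first exact: (IH f _ f1 h1 0).
by rewrite iterSr; apply: IH.
Qed.

(** For large [m] the means of [P^r] are within [1/2] of [M f = 0]. If the [m]-th lazy iterate
    exceeded [1 - 2^-m / 2] at [x], [lazy_close] would put all the terms of the mean of order [m],
    hence the mean, above [1/2]. *)
Lemma lazy_contraction r : (0 < r)%N -> exists m c, 0 <= c < 1 /\
  forall f, (forall y, `|f y| <= 1) -> M f = 0 ->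
  forall x, `|iter m (lazy r) f x| <= c.
Proof.
move=> r0; have e2 : (0 : R) < 1 / 2 by lra.
have iMr : invariant_state (iter r P) M.
  by split=> // f; rewrite (invariant_iter iM).
have [m' Hm'] := avg_uniform_cvg (markov_pow r mP) iMr (uniqM r0)
  (sigma_iter mP sigmaP r) e2.
pose m := maxn 1 m'; have m0 : (0 < m)%N by exact: leq_maxl.
have p0 : (0 : R) < 2^-1 ^+ m by rewrite exprn_gt0.
have p1 : (2^-1 : R) ^+ m <= 1 by rewrite exprn_ile1 // invf_le1 // ler1n.
have upper f : (forall y, `|f y| <= 1) -> M f = 0 ->
    forall x, iter m (lazy r) f x <= 1 - 2^-1 ^+ m / 2.
  move=> f1 Mf x; rewrite leNgt; apply/negP => fx.
  pose c := 1 - iter m (lazy r) f x.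
  have f1' y : f y <= 1 by rewrite (le_trans (ler_norm _)).
  have := lazy_close (m := m) (c := c) (x := x) (r := r) f1'.
  rewrite subKr lexx => /(_ isT) close.
  have : 1 - 2 ^+ m * c <= avg m (iter r P) f x.
    by apply: avg_ge_cst => // k /andP[_ km]; exact: close.
  have := Hm' m (leq_maxr _ _) f f1 x; rewrite Mf subr0 ler_norml => /andP[_ h1] h2.
  have : 2 ^+ m * c < 2 ^+ m * (2^-1 ^+ m / 2).
    by rewrite ltr_pM2l ?exprn_gt0 // /c; move: fx; clear; lra.
  rewrite mulrA -exprMn mulfV // expr1n; move: h1 h2; clear.
  by move: (2 ^+ m * c) => b; lra.
exists m, (1 - 2^-1 ^+ m / 2); split; first by apply/andP; split; lra.
move=> f f1 Mf x; rewrite ler_norml; apply/andP; split; last exact: upper.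
rewrite lerNl -bmfun_opp -(markovN (markov_pow m (markov_lazy r))).
by apply: upper => [y|]; rewrite ?bmfun_opp ?normrN // (stateN sM) Mf oppr0.
Qed.

Lemma lazy_contraction_unif n : exists m c, 0 <= c < 1 /\
  forall r, (0 < r < n)%N -> forall f, (forall y, `|f y| <= 1) -> M f = 0 ->
  forall x, `|iter m (lazy r) f x| <= c.
Proof.
elim: n => [|n [m [c [/andP[c0 c1] IH]]]].
  by exists 0, 0; rewrite lexx ltr01; split=> // r; rewrite ltn0 andbF.
have [->|n0] := posnP n; first by exists 0, 0; rewrite lexx ltr01; split=> // -[|[]].
have [m' [c' [/andP[c'0 c'1] H]]] := lazy_contraction n0.
have more k l r f a : (k <= l)%N -> (forall x, `|iter k (lazy r) f x| <= a) ->
    forall x, `|iter l (lazy r) f x| <= a.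
  move=> kl fa x; rewrite -(subnK kl) iterD.
  exact: (state_norm_le (markov_pow _ (markov_lazy r) x)).
exists (maxn m m'), (Num.max c c'); split.
  by rewrite le_max c0 /= gt_max c1 c'1.
move=> r /andP[r0]; rewrite ltnS leq_eqVlt => /orP[/eqP-> | rn] f f1 Mf x.
  rewrite le_max; apply/orP; right; apply: (more m') => //; first exact: leq_maxr.
  exact: H.
rewrite le_max; apply/orP; left; apply: (more m); first exact: leq_maxl.
by apply: IH => //; rewrite r0.
Qed.

Lemma foldr_lazy_rem r s f : r \in s ->
  foldr lazy f s = lazy r (foldr lazy f (rem r s)).
Proof.
elim: s => //= a s IH; rewrite inE; have [->//|ar /= /IH->] := eqVneq r a.
by rewrite lazy_comm.
Qed.

(** The lazy operators commute, so [m] occurrences of [r] can be moved to the front. *)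
Lemma foldr_lazy_count r m s f : (m <= count_mem r s)%N ->
  exists s', foldr lazy f s = iter m (lazy r) (foldr lazy f s').
Proof.
elim: m s => [|m IH] s ms; first by exists s.
have rs : r \in s by rewrite -has_pred1 has_count (leq_ltn_trans _ ms).
have [|s' Hs'] := IH (rem r s); last by exists s'; rewrite (foldr_lazy_rem _ rs) Hs'.
by move: ms; rewrite count_rem rs /= eqxx; lia.
Qed.

Lemma pigeonhole_count n m s : all (fun r => (r < n)%N) s ->
  (forall r, (r < n)%N -> (count_mem r s <= m)%N) -> (size s <= n * m)%N.
Proof.
move=> sn sm; suff -> : size s = (\sum_(r < n) count_mem (r : nat) s)%N.
  rewrite -[n in (n * m)%N]card_ord -sum_nat_const; apply: leq_sum => r _.
  exact: sm.
elim: s sn {sm} => [_|a s IH /= /andP[an /IH->]]; first by rewrite big1.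
rewrite -add1n big_split /=; congr (_ + _)%N.
rewrite (bigD1 (Ordinal an)) //=. rewrite eqxx big1 ?addn0 // => i ia.
by case: eqP => // ai; case/eqP: ia; apply: val_inj.
Qed.

(** Induction on [j]: [overlap] is applied to [P^(2Nj) g]. Its image under [lazy r] is
    [P^(2Nj) (lazy r g)], bounded by the induction hypothesis for [lazy r g]. Each round costs a
    factor [4]. *)
Lemma iter_words : exists2 N, (0 < N)%N & forall j g b, (forall y, `|g y| <= 1) ->
  (forall s, size s = j -> all (fun r => (0 < r < N.*2)%N) s ->
     forall y, `|foldr lazy g s y| <= b) ->
  forall x, `|iter (j * N.*2) P g x| <= 1 - 4^-1 ^+ j * (1 - b).
Proof.
have [N N0 HN] := overlap; exists N => //; elim=> [|j IH] g b g1 gb x.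
  by rewrite expr0 mul1r subKr; exact: (gb [::]).
rewrite mulSn iterD exprS -mulrA mulrC.
have := HN (iter (j * N.*2) P g) (1 - 4^-1 ^+ j * (1 - b)).
rewrite subKr; apply=> [y|r rN y]; first exact: (state_norm_le (markov_pow _ mP y)).
rewrite lazy_iter; apply: IH => [z|s sj sN z].
  exact: (state_norm_le (markov_lazy r z)).
rewrite -foldr_rcons; apply: gb; first by rewrite size_rcons sj.
by rewrite all_rcons rN.
Qed.

Lemma iter_contraction : exists m c, 0 <= c < 1 /\
  forall f a, (forall y, `|f y| <= a) -> M f = 0 -> forall x, `|iter m P f x| <= c * a.
Proof.
have [N N0 HN] := iter_words.
have [m [c [/andP[c0 c1] Hm]]] := lazy_contraction_unif N.*2.
(* The length at which a word with letters below [2N] must contain some letter at least [m]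
   times. *)
pose j := (N.*2 * m).+1; pose t : R := 4^-1 ^+ j.
have t0 : 0 < t by rewrite exprn_gt0.
have t1 : t <= 1 by rewrite exprn_ile1 // invf_le1 // ler1n.
have main f : (forall y, `|f y| <= 1) -> M f = 0 ->
    forall x, `|iter (j * N.*2) P f x| <= 1 - t * (1 - c).
  move=> f1 Mf; apply: HN => // s sj sN.
  have lt_s r : r \in s -> (0 < r < N.*2)%N by move=> rs; exact: (allP sN).
  have [r rs rm] : exists2 r, r \in s & (m <= count_mem r s)%N.
    apply: contrapT => H; have := @pigeonhole_count N.*2 m s.
    rewrite sj /j ltnn => /(_ _ _)/notF; apply.
      by apply/allP => r /lt_s/andP[].
    move=> r _; have [rs|rs] := boolP (r \in s).
      by apply/ltnW; rewrite ltnNge; apply/negP => rm; apply: H; exists r.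
    by rewrite (count_memPn rs).
  have [s' ->] := foldr_lazy_count f rm; apply: Hm; first exact: lt_s.
    elim: s' => //= a s' IH y; exact: (state_norm_le (markov_lazy a y)).
  by elim: s' => //= a s' IH; rewrite invariant_lazy.
exists (j * N.*2)%N, (1 - t * (1 - c)); split.
  by apply/andP; split; nra.
move=> f a fa Mf x; have a0 : 0 <= a by exact: le_trans (fa x).
have [a00|an0] := eqVneq a 0.
  rewrite a00 mulr0; apply: (state_norm_le (markov_pow _ mP x)) => y.
  by rewrite -a00.
have ap : 0 < a by rewrite lt_neqAle eq_sym an0.
have := main (a^-1 *: f) _ _ x.
rewrite (stateZ sM) Mf mulr0 (markovZ (markov_pow _ mP)) bmfun_scale normrM.
rewrite ger0_norm ?invr_ge0 // ler_pdivrMl // mulrC; apply=> // y.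
by rewrite bmfun_scale normrM ger0_norm ?invr_ge0 // ler_pdivrMl // mulr1.
Qed.

(** The contraction acts on [f - M f], of norm at most [2] and in the kernel of [M]; iterating [P]
    further does not increase the norm. *)
Theorem iter_uniform_cvg (e : R) : 0 < e ->
  exists N, forall n, (N <= n)%N -> forall f, (forall y, `|f y| <= 1) ->
    forall x, `|iter n P f x - M f| <= e.
Proof.
move=> e0; have [m [c [/andP[c0 c1] Hm]]] := iter_contraction.
have powers j f : (forall y, `|f y| <= 2) -> M f = 0 ->
    forall x, `|iter (j * m) P f x| <= c ^+ j * 2.
  move=> f2 Mf; elim: j => [|j IH] x; first by rewrite mul1r.
  rewrite mulSn iterD exprS -mulrA; apply: Hm => //.
  by rewrite (invariant_iter iM).
have [j Hj] : exists j, c ^+ j * 2 <= e.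
  have : c ^+ n @[n --> \oo] --> (0 : R) by apply: cvg_expr; rewrite ger0_norm.
  move/cvgrPdist_le => /(_ (e / 2))[|j _ /(_ j (leqnn j)) /=]; first by lra.
  rewrite sub0r normrN => h; exists j; have := le_trans (ler_norm _) h.
  by move: (c ^+ j) => z; lra.
exists (j * m)%N => n jn f f1 x.
pose g := f - M f *: oneb.
have g2 y : `|g y| <= 2.
  rewrite /g !bmfunE mulr1 (le_trans (ler_normB _ _)) //.
  by have := f1 y; have := state_norm_le sM f1; lra.
have Mg : M g = 0 by rewrite /g (stateB sM) (stateZ sM) (state_one sM) mulr1 subrr.
have -> : iter n P f x - M f = iter n P g x.
  have mn := markov_pow n mP.
  by rewrite /g (markovB mn) (markovZ mn) (markov_one mn) !bmfunE mulr1.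
rewrite -(subnK jn) iterD; apply: (state_norm_le (markov_pow _ mP x)) => y.
exact: le_trans (powers j g g2 Mg y) Hj.
Qed.

End UniformMixing.

(** * Finitely additive measures as states *)

Section SetFunctionOfState.
Context d (X : measurableType d) (R : realType).
Local Notation V := (bmfun X R).
Implicit Types (f g : V) (E : set X) (F G : V -> R).

Lemma uniform_cvgP (h : nat -> X -> R) (u : X -> R) :
  {uniform, h @ \oo --> u} <->
  forall e : R, 0 < e -> exists N, forall n, (N <= n)%N ->
    forall x, `|u x - h n x| < e.
Proof.
split=> [hu e e0|hu A].
  have : nbhs (u : {uniform X -> R}) [set v : X -> R | forall x, `|u x - v x| < e].
    apply/uniform_nbhs; exists [set xy : R * R | `|xy.1 - xy.2| < e]; split.
      by rewrite -entourage_ballE; exists e.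
    by move=> v uv x; exact: uv.
  by move/hu => [N _ HN]; exists N => n /HN.
move=> /uniform_nbhs[B [entB BA]].
move: entB; rewrite -entourage_ballE => -[e /= e0 eB].
have [N HN] := hu e e0; exists N => // n /= Nn; apply: BA => x _.
by apply: eB; exact: HN.
Qed.

Definition setf F : setfun X R :=
  fun E => if `[< measurable E >] then F (indb R E) else 0.

Lemma setfE F E : measurable E -> setf F E = F (indb R E).
Proof. by move=> mE; rewrite /setf asboolT. Qed.

Lemma setf_nonmeas F E : ~ measurable E -> setf F E = 0.
Proof. by move=> mE; rewrite /setf asboolF. Qed.

Lemma measurable_sfun_preimage (h : {sfun X >-> R}) (r : R) :
  measurable (h @^-1` [set r]).
Proof. exact: measurable_sfunP. Qed.

Lemma mkb_sfun (h : {sfun X >-> R}) : mkb h = h :> (X -> R).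
Proof.
have [C [_ hC]] := simple_bounded h.
apply: (mkbE (C := C + 1)) => // x.
by apply: (hC (C + 1)) => //; rewrite ltrDl.
Qed.

Lemma sintegral_setf F (h : {sfun X >-> R}) : state F ->
  sintegral (fun E => (setf F E)%:E) h = (F (mkb h))%:E.
Proof.
move=> sF; rewrite /sintegral -(fsbig_widen (range h)) //=; last first.
  move=> r [_ /= hr]; rewrite preimage10 // setfE // (_ : indb R set0 = 0) ?state0 ?mule0 //.
  by apply: bmfunP => x; rewrite indbE // in_set0 bmfunE.
have fin : finite_set (range h) by exact: fimfunP.
rewrite fsbig_finite //=; under eq_bigr do rewrite -EFinM.
rewrite sumEFin; congr (_%:E).
pose s : seq R := finmap.enum_fset (fset_set (range h)).
have -> : mkb h = \sum_(r <- s) r *: indb R (h @^-1` [set r]).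
  apply: bmfunP => x; rewrite mkb_sfun bmfun_sum.
  have hxs : h x \in s by rewrite /s in_fset_set // inE; exists x.
  have us : uniq s by exact: finmap.fset_uniq.
  rewrite (bigD1_seq (h x)) //= bmfun_scale indbE; last exact: measurable_sfun_preimage.
  rewrite mem_set // mulr1 big1 ?addr0 // => r rx.
  rewrite bmfun_scale indbE; last exact: measurable_sfun_preimage.
  by rewrite memNset ?mulr0 //= => hr; move: rx; rewrite hr eqxx.
rewrite (state_sum sF); apply: eq_bigr => r _.
by rewrite (stateZ sF) setfE //; exact: measurable_sfun_preimage.
Qed.

Lemma sfun_layers (E : nat -> set X) (c a : R) K : (forall k, measurable (E k)) ->
  exists h : {sfun X >-> R}, forall x, h x = c + a * \sum_(k < K) (x \in E k)%:R.
Proof.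
move=> mE; elim: K => [|K [h IH]].
  by exists (cst_sfun c : {sfun X >-> R}) => x; rewrite big_ord0 mulr0 addr0.
exists (h + scale_sfun a (indic_sfun _ (mE K))) => x.
by rewrite big_ord_recr /= mulrDr addrA -IH /= -indicE [in RHS]mulrC.
Qed.

(** Counting multiples of [a] below [v] builds a staircase under [v]. Only [K] steps are counted
    although [v] may reach [(K+1) a]; the error is still at most [a]. *)
Lemma layers_approx (a v : R) K : 0 <= a -> 0 <= v <= K.+1%:R * a ->
  v - a <= a * \sum_(k < K) (k.+1%:R * a < v)%R%:R <= v.
Proof.
move=> a0; elim: K => [|K IH] /andP[v0 vK].
  by rewrite big_ord0 mulr0 v0 subr_le0 andbT -[leRHS]mul1r.
rewrite big_ord_recr /=; have [lt_v|le_v] := ltP (K.+1%:R * a) v; last first.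
  by rewrite addr0 IH // v0 le_v.
rewrite (eq_bigr (fun=> 1)) => [|k _].
  rewrite sumr_const card_ord -(natrD _ K 1) addn1 mulrC (ltW lt_v) andbT.
  by rewrite lerBlDr -{2}(mul1r a) -mulrDl natr1.
rewrite (le_lt_trans _ lt_v) // ler_wpM2r // ler_nat ltnS.
exact: (ltnW (ltn_ord k)).
Qed.

Lemma sfun_approx f (e : R) : 0 < e ->
  exists h : {sfun X >-> R}, forall x, `|f x - h x| <= e.
Proof.
move=> e0; have [C fC] := bmfun_bounded f.
pose E k := [set x | k.+1%:R * e - C < f x].
have mE k : measurable (E k) by exact: measurable_bmfun_gt.
pose K := Num.bound (2 * C / e).
have [h Hh] := sfun_layers (- C) e K mE.
exists h => x; have := fC x; rewrite ler_norml => /andP[f1 f2].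
have C0 : 0 <= C by exact: le_trans (fC x).
have vK : 0 <= f x + C <= K.+1%:R * e.
  apply/andP; split; first by lra.
  have : 2 * C / e <= K%:R.
    by apply/ltW/archi_boundP; rewrite divr_ge0 ?(ltW e0) // mulr_ge0.
  rewrite ler_pdivrMr // => h2; apply: (@le_trans _ _ (K%:R * e)); first by lra.
  by rewrite ler_wpM2r ?(ltW e0) // ler_nat.
have := layers_approx (ltW e0) vK; rewrite Hh.
rewrite (eq_bigr (fun k : 'I_K => (x \in E k)%:R)) => [|k _]; last first.
  congr (nat_of_bool _)%:R; rewrite /E; apply/idP/idP; rewrite inE /=; lra.
by move: (e * _) => z; rewrite ler_norml => /andP[? ?]; apply/andP; split; lra.
Qed.

(** A state is continuous for the sup-norm, so every uniform approximation of [f] by simple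
    functions yields the limit [F f]. By [sfun_approx] one exists, so [xget] does not fall back on
    its default [0]. *)
Lemma ba_integral_setf F f : state F -> ba_integral (setf F) f = F f.
Proof.
move=> sF; rewrite /ba_integral; case: xgetP => [I _ [h [hf hI]]|H]; last first.
  exfalso.
  have /choice[h Hh] (n : nat) : exists h : {sfun X >-> R},
      forall x, `|f x - h x| <= n.+1%:R^-1.
    by apply: sfun_approx; rewrite invr_gt0 ltr0n.
  apply: (H (F f)); exists h.
  have hf (e : R) : 0 < e -> exists N, forall n, (N <= n)%N ->
      forall x, `|f x - h n x| <= e.
    move=> e0; have [N HN] := small_div ler01 e0; exists N => n Nn x.
    by rewrite (le_trans (Hh n x)) // -div1r HN.
  split.
    apply/uniform_cvgP => e e0; have e2 : 0 < e / 2 by lra.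
    have [N HN] := hf _ e2; exists N => n Nn x.
    by rewrite (le_lt_trans (HN n Nn x)) //; lra.
  under eq_cvg do rewrite (sintegral_setf _ sF).
  apply: cvg_EFin; first exact: nearW.
  apply/cvgrPdist_le => e e0; have [N HN] := hf e e0.
  exists N => // n /= Nn; rewrite -(stateB sF).
  by apply: (state_norm_le sF) => x; rewrite !bmfunE mkb_sfun; exact: HN.
have hF : F (mkb (h n)) @[n --> \oo] --> F f.
  apply/cvgrPdist_le => e e0; have /uniform_cvgP/(_ e e0)[N HN] := hf.
  exists N => // n /= Nn; rewrite -(stateB sF).
  apply: (state_norm_le sF) => x; rewrite !bmfunE mkb_sfun; apply/ltW.
  exact: HN.
have hFE : sintegral (fun E => (setf F E)%:E) (h n) @[n --> \oo] --> (F f)%:E.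
  under eq_cvg do rewrite (sintegral_setf _ sF).
  by apply: cvg_EFin => //; exact: nearW.
by apply: EFin_inj; exact: (cvg_unique _ hI hFE).
Qed.

Lemma setf_inj F G : state F -> state G -> setf F = setf G -> forall f, F f = G f.
Proof. by move=> sF sG FG f; rewrite -(ba_integral_setf f sF) FG ba_integral_setf. Qed.

End SetFunctionOfState.

(** * Total variation and states *)

Section TotalVariation.
Context d (X : measurableType d) (R : realType).
Local Notation V := (bmfun X R).
Implicit Types (f g : V) (E : set X) (F G : V -> R).

Lemma disjoint_comb_norm n (E : 'I_n -> set X) (s : 'I_n -> R) :
  (forall i, measurable (E i)) -> trivIset [set: 'I_n] E ->
  (forall i, `|s i| <= 1) -> forall x, `|(\sum_i s i *: indb R (E i)) x| <= 1.
Proof.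
move=> mE tE s1 x; rewrite bmfun_sum.
have [[i Ex]|nE] := pselect (exists i, E i x); last first.
  rewrite big1 ?normr0 // => i _; rewrite bmfun_scale indbE // memNset ?mulr0 //.
  by move=> Ex; apply: nE; exists i.
rewrite (bigD1 i) //= big1 => [|j ji]; last first.
  rewrite bmfun_scale indbE // memNset ?mulr0 // => Ejx; case/eqP: ji.
  by apply: tE => //; exists x.
by rewrite addr0 bmfun_scale indbE // mem_set // mulr1.
Qed.

(** Weighting disjoint sets by the signs of the differences gives a function of norm at most [1] on
    which [F - G] equals the variation sum. *)
Lemma tv_norm_le F G (c : R) : state F -> state G ->
  (forall f, (forall x, `|f x| <= 1) -> F f - G f <= c) ->
  (tv_norm (setf F - setf G)%R <= c%:E)%E.
Proof.
move=> sF sG FG; apply: ge_ereal_sup => _ [n [E [mE tE ->]]]; rewrite lee_fin.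
pose s i : R := Num.sg (F (indb R (E i)) - G (indb R (E i))).
have s1 i : `|s i| <= 1 by rewrite /s normr_sg lern1 leq_b1.
have := FG _ (disjoint_comb_norm mE tE s1); apply: le_trans.
rewrite (state_sum sF) (state_sum sG) -sumrB; apply: ler_sum => i _.
rewrite (stateZ sF) (stateZ sG) -mulrBr /s -normrEsg.
by rewrite -!(setfE _ (mE i)).
Qed.

Lemma S_ba_setf F : state F -> S_ba X R (setf F).
Proof.
move=> sF; have F0 E : 0 <= F (indb R E) by exact: state_indb_ge0.
have indb1 E x : measurable E -> `|indb R E x| <= 1.
  by move=> mE; rewrite indbE //; case: (_ \in _); rewrite ?normr1 ?normr0.
split.
- split; first exact: setf_nonmeas.
    by move=> A B mA mB AB; rewrite !setfE ?(state_indbU sF) //; exact: measurableU.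
  exists 1 => E mE; rewrite setfE //; apply: (state_norm_le sF) => x; exact: indb1.
- by move=> E mE; rewrite setfE.
- apply/eqP; rewrite eq_le; apply/andP; split.
    apply: ge_ereal_sup => _ [n [E [mE tE ->]]]; rewrite lee_fin.
    rewrite (eq_bigr (fun i => F (1 *: indb R (E i)))) => [|i _]; last first.
      by rewrite setfE // scale1r ger0_norm.
    rewrite -(state_sum sF); apply: le_trans (ler_norm _) _.
    apply: (state_norm_le sF); apply: disjoint_comb_norm => // i.
    by rewrite normr1.
  apply: ereal_sup_ubound; exists 1, (fun=> setT); split => //.
    by move=> i j _ _ _; rewrite (ord1 i) (ord1 j).
  by rewrite big_ord1 setfE // -/oneb (state_one sF) normr1.
Qed.

End TotalVariation.

(** * Lebesgue integrals as countably additive states *)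

Section LebesgueState.
Context d (X : measurableType d) (R : realType).
Local Notation V := (bmfun X R).
Variable m : {measure set X -> \bar R}.
Hypothesis m1 : m setT = 1%E.

Definition integ (f : V) : R := Rintegral m setT f.

Lemma integrable_bmfun (f : V) : m.-integrable setT (EFin \o f).
Proof.
apply: measurable_bounded_integrable => //.
- by rewrite m1 ltry.
- exact: bmfun_meas.
have [C fC] := bmfun_bounded f; exists C; split; first exact: num_real.
by move=> D CD x _; exact: le_trans (fC x) (ltW CD).
Qed.

Lemma integ_indb E : measurable E -> integ (indb R E) = fine (m E).
Proof.
move=> mE; rewrite /integ /Rintegral.
rewrite (eq_integral (fun x => (\1_E x)%:E)) => [|x _]; last by rewrite indbE.
by rewrite integral_indic // setIT.
Qed.

Lemma state_integ : state integ.
Proof.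
split=> [a f g|f f0|].
- rewrite /integ -RintegralZl // -?RintegralD //; last 2 first.
  + exact: integrable_bmfun.
  + exact: integrable_bmfun.
  exact: (integrable_bmfun (a *: f)).
- exact: Rintegral_ge0.
- by rewrite integ_indb // m1.
Qed.

Lemma sigma_integ : sigma_state integ.
Proof.
move=> u u01 u0.
have ms n : measurable_fun setT (EFin \o u n).
  by apply/measurable_EFinP; exact: bmfun_meas.
have [] := @dominated_convergence _ _ _ m setT measurableT (fun n => EFin \o u n)
  (cst 0%E) (EFin \o (oneb : V)) ms (measurable_cst _).
- by apply: aeW => x _ /=; apply: cvg_EFin; [exact: nearW|exact: u0].
- exact: integrable_bmfun.
- apply: aeW => x n _ /=; rewrite lee_fin onebE.
  by have /andP[u00 u1] := u01 n x; rewrite ger0_norm.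
move=> _ _; rewrite integral0 => /fine_cvg; exact.
Qed.

End LebesgueState.

(** * The operator on functions induced by the transition kernel *)

Section KernelOperator.
Context d (X : measurableType d) (R : realType) (p : R.-pker X ~> X).
Local Notation V := (bmfun X R).

Definition kernel_op (f : V) : V := mkb (fun x => integ (p x) f).

Let p1 x : p x setT = 1%E. Proof. exact: prob_kernel. Qed.

Lemma kernel_opE f x : kernel_op f x = integ (p x) f.
Proof.
have [C fC] := bmfun_bounded f.
have sI y := state_integ (p1 y).
rewrite /kernel_op (mkbE (C := C)) // => [|y]; last exact: (state_norm_le (sI y)).
have C0 : 0 <= C by exact: le_trans (fC x).
(* The shift by [C] makes the integrand nonnegative, as measurability of the integral against a
   kernel requires here. *)
pose g : V := f + C *: oneb.
have g0 y : 0 <= g y.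
  by have := fC y; rewrite ler_norml !bmfunE mulr1 => /andP[? _]; lra.
have -> : (fun y => integ (p y) f) = (fun y => integ (p y) g - C).
  apply/funext => y; rewrite (stateD (sI y)) (stateZ (sI y)) (state_one (sI y)).
  by rewrite mulr1 addrK.
apply: measurable_funB; last exact: measurable_cst.
apply: (measurableT_comp (f := fine)) => //.
apply: (measurable_fun_integral_finite_kernel (fun xy : X * X => (g xy.2)%:E) p).
  by move=> z; rewrite lee_fin.
apply/measurable_EFinP; apply: (measurableT_comp (f := (g : X -> R))) => //.
exact: bmfun_meas.
Qed.

Lemma markov_kernel_op : markov kernel_op.
Proof.
move=> x; have := state_integ (p1 x).
by congr state; apply/funext => f; rewrite kernel_opE.
Qed.

Lemma sigma_kernel_op x : sigma_state (fun f => kernel_op f x).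
Proof.
have := sigma_integ (p1 x).
by congr sigma_state; apply/funext => f; rewrite kernel_opE.
Qed.

(** [p x E] is [kernel_op] of the indicator of [E] at [x], and integrating against [setf F] amounts
    to applying [F]. *)
Lemma markov_op_setf (F : V -> R) : state F ->
  markov_op p (setf F) = setf (F \o kernel_op).
Proof.
move=> sF; apply/funext => E; rewrite /markov_op; case: asboolP => mE; last first.
  by rewrite setf_nonmeas.
rewrite setfE //= -(ba_integral_setf _ sF); congr ba_integral; apply/funext => x.
by rewrite kernel_opE integ_indb.
Qed.

Lemma markov_iter_setf (F : V -> R) k : state F ->
  markov_iter p k (setf F) = setf (F \o iter k kernel_op).
Proof.
move=> sF; elim: k => [//|k IH]; rewrite /markov_iter iterS -/(markov_iter p k _) IH.
rewrite markov_op_setf; last exact: state_comp (markov_pow _ markov_kernel_op).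
by congr setf; apply/funext => f /=; rewrite iter_comm.
Qed.

Lemma cesaro_mean_setf (F : V -> R) n : state F ->
  cesaro_mean p n (setf F) = setf (F \o avg n kernel_op).
Proof.
move=> sF; apply/funext => E; rewrite /cesaro_mean.
have -> : (\sum_(1 <= k < n.+1) markov_iter p k (setf F)) =
          (\sum_(1 <= k < n.+1) setf (F \o iter k kernel_op)).
  by apply: eq_bigr => k _; rewrite markov_iter_setf.
rewrite /GRing.scale /= fct_sumE.
have [mE|mE] := pselect (measurable E); last first.
  by rewrite setf_nonmeas // big1 ?scaler0 // => k _; rewrite setf_nonmeas.
rewrite setfE //= avg_def (stateZ sF) (state_sum sF); congr (_ * _).
by apply: eq_bigr => k _; rewrite setfE.
Qed.

Lemma Delta_ba_setf (F : V -> R) : invariant_state kernel_op F -> Delta_ba p (setf F).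
Proof.
move=> [sF iF]; split; first exact: S_ba_setf.
by rewrite markov_op_setf //; congr setf; apply/funext => f /=; rewrite iF.
Qed.

End KernelOperator.

(** * Initial measures as states *)

Section CountablyAdditive.
Context d (X : measurableType d) (R : realType) (eta : setfun X R).
Hypothesis Seta : S_ca X R eta.

Let meta (E : set X) : \bar R := (eta E)%:E.

Let eta_ba : ba X R eta. Proof. by case: Seta => -[]. Qed.

Let meta0 : meta set0 = 0%E.
Proof.
have [_ /(_ set0 set0 measurable0 measurable0 (setI0 _)) + _] := eta_ba.
by rewrite setU0 /meta -EFinD => -[]; move: (eta set0) => a h; congr EFin; lra.
Qed.

Let meta_ge0 E : (0 <= meta E)%E.
Proof.
have [[[nm _ _] pos _] _] := Seta; rewrite /meta lee_fin.
by have [/pos|/nm->] := pselect (measurable E).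
Qed.

Let meta_sigma : semi_sigma_additive meta. Proof. by have [_ []] := Seta. Qed.

HB.instance Definition _ := isMeasure.Build d X R meta meta0 meta_ge0 meta_sigma.

Let meta1 : meta setT = 1%E.
Proof.
have [[_ pos tv] _] := Seta; rewrite -tv; apply/eqP; rewrite eq_le; apply/andP; split.
  apply: ereal_sup_ubound; exists 1, (fun=> setT); split => //.
    by move=> i j _ _ _; rewrite (ord1 i) (ord1 j).
  by rewrite big_ord1 ger0_norm // pos.
apply: ge_ereal_sup => _ [n [E [mE tE ->]]].
rewrite -sumEFin (eq_bigr (fun i => meta (E i))) => [|i _]; last first.
  by rewrite ger0_norm // pos.
rewrite -(measure_bigsetU_ord [the measure _ _ of meta] xpredT mE tE).
apply: (@le_measure _ _ _ [the measure X R of meta]); rewrite ?inE //.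
exact: bigsetU_measurable.
Qed.

(** The state is the Lebesgue integral against [eta]. *)
Lemma S_ca_setf : exists2 F : bmfun X R -> R, state F & eta = setf F.
Proof.
exists (integ meta); first exact: (state_integ meta1).
apply/funext => E; have [mE|mE] := pselect (measurable E).
  by rewrite setfE // (integ_indb _ mE).
by rewrite setf_nonmeas //; have [nm _ _] := eta_ba; exact: nm.
Qed.

End CountablyAdditive.

(** * Uniqueness of invariant states, also for powers when there is no cycle *)

Section CycleFree.
Context d (X : measurableType d) (R : realType) (p : R.-pker X ~> X).
Local Notation V := (bmfun X R).
Local Notation P := (kernel_op p).
Variable M : V -> R.
Hypothesis Delta_M : Delta_ba p = [set setf M].
Hypothesis sM : state M.

Let mP : markov P := markov_kernel_op p.

Lemma invariant_state_unique G : invariant_state P G -> forall f, G f = M f.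
Proof.
move=> iG; have := Delta_ba_setf iG; rewrite Delta_M => GM.
exact: setf_inj (proj1 iG) sM GM.
Qed.

(* A [P^r]-invariant state [G] has a least period [q]; its orbit
   [G, G o P, ..., G o P^(q-1)] is a cycle unless [q = 1]. *)
Lemma power_invariant_state_unique r : simple_measure p (setf M) -> (0 < r)%N ->
  forall G, invariant_state (iter r P) G -> forall f, G f = M f.
Proof.
move=> simple r0 G [sG iG].
have sGk k : state (G \o iter k P) by exact: state_comp (markov_pow k mP).
pose nu k := setf (G \o iter k P).
have opnu k : markov_op p (nu k) = nu k.+1.
  by rewrite /nu markov_op_setf //; congr setf; apply/funext => f; rewrite /= iter_comm.
have nuD k j : nu k = nu j -> forall i, nu (k + i)%N = nu (j + i)%N.
  by move=> kj; elim=> [|i IH]; rewrite ?addn0 // !addnS -!opnu IH.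
have ex_period : exists q, (0 < q)%N && `[< nu q = nu 0 >].
  exists r; rewrite r0; apply/asboolP; congr setf; apply/funext => f.
  exact: iG.
case: (ex_minnP ex_period) => q /andP[q0 /asboolP nuq] qmin.
have [q1|q2] := leqP q 1.
  have {}q1 : q = 1 by apply/eqP; rewrite eqn_leq q1.
  apply: invariant_state_unique; split=> // f.
  by have := setf_inj (sGk 1) (sGk 0) _ f; apply; rewrite -/(nu 1) -q1.
exfalso; apply: simple; exists q, (fun i : 'I_q => nu i).
have nu_mod (k : nat) : nu (k %% q)%N = nu k.
  rewrite {2}(divn_eq k q); elim: (k %/ q)%N => [|m IH]; first by rewrite mul0n.
  by rewrite mulSn -addnA; have := nuD _ _ nuq (m * q + k %% q)%N => ->.
split.
  split=> // [i j|i|i]; last 2 first.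
  - exact: S_ba_setf.
  - by rewrite opnu -nu_mod.
  (* Advancing [nu a = nu b] by [q - b] steps gives [nu (a + (q - b)) = nu q = nu 0], a period
     shorter than [q]. *)
  have sep (a b : nat) : (a < b)%N -> (b < q)%N -> nu a <> nu b.
    move=> ab bq eq_ab; have := nuD _ _ eq_ab (q - b)%N.
    rewrite subnKC ?(ltnW bq) // nuq => /asboolP per.
    have := qmin (a + (q - b))%N; rewrite per andbT addn_gt0 subn_gt0 bq orbT.
    move=> /(_ isT); lia.
  move=> nuij; apply: val_inj; have [ij|ji|//] := ltngtP (val i) (val j).
  - by case: (sep _ _ ij (ltn_ord j)).
  - by case: (sep _ _ ji (ltn_ord i)).
pose A (f : V) := q%:R^-1 * \sum_(1 <= k < q.+1) (G \o iter k.-1 P) f.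
have sA : state A := state_mean q0 (fun k => sGk k.-1).
have setA : setf A = q%:R^-1 *: \sum_(i < q) nu i.
  apply/funext => E; rewrite /GRing.scale /= fct_sumE.
  have [mE|mE] := pselect (measurable E); last first.
    by rewrite setf_nonmeas // big1 ?scaler0 // => i _; rewrite /nu setf_nonmeas.
  rewrite setfE // /A big_add1 /= big_mkord; congr (_ * _).
  by apply: eq_bigr => i _; rewrite /nu setfE.
(* [A (P f) - A f] telescopes to [(G (P^q f) - G f) / q = 0]. By uniqueness the average over the
   cycle is then [M]. *)
have iA : invariant_state P A.
  split=> // f; rewrite /A; congr (_ * _); apply/eqP; rewrite -subr_eq0 -sumrB.
  rewrite big_add1 /= (eq_bigr (fun k => G (iter k.+1 P f) - G (iter k P f))).
    rewrite telescope_sumr // subr_eq0; apply/eqP.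
    exact: (setf_inj (sGk q) (sGk 0) nuq).
  by move=> k _ /=; rewrite iter_comm.
rewrite -setA; congr setf; apply/funext => f.
by rewrite (invariant_state_unique iA).
Qed.

End CycleFree.

(** A state [F] applied to [Q n f - M f] is at most the sup-norm of this function, a bound that is
    the same for all initial measures. *)
Lemma unif_tv_cvg_setf d (X : measurableType d) (R : realType) (M : bmfun X R -> R)
    (u : nat -> setfun X R -> setfun X R) (Q : nat -> bmfun X R -> bmfun X R) :
  state M -> (forall n, (0 < n)%N -> markov (Q n)) ->
  (forall n F, state F -> u n (setf F) = setf (F \o Q n)) ->
  (forall e : R, 0 < e -> exists N, forall n, (N <= n)%N ->
    forall f : bmfun X R, (forall y, `|f y| <= 1) -> forall x, `|Q n f x - M f| <= e) ->
  unif_tv_cvg u (setf M).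
Proof.
move=> sM mQ uQ cvgQ e e0; have e2 : 0 < e / 2 by lra.
have [N HN] := cvgQ _ e2; exists (maxn 1 N) => // n /=.
rewrite geq_max => /andP[n0 Nn] eta /S_ca_setf[F sF ->]; rewrite uQ //.
apply: (@le_lt_trans _ _ (e / 2)%:E); last by rewrite lte_fin; lra.
apply: tv_norm_le => // [|f f1]; first exact: state_comp (mQ n n0).
have -> : (F \o Q n) f - M f = F (Q n f - M f *: oneb).
  by rewrite (stateB sF) (stateZ sF) (state_one sF) mulr1.
apply: (state_le_cst sF) => x; rewrite !bmfunE mulr1.
exact: le_trans (ler_norm _) (HN n Nn f f1 x).
Qed.

Theorem theorem5p4 (R : realType) (d : measure_display) (X : measurableType d)
    (X_infinite : infinite_set [set: X])
    (measurable_singleton : forall x : X, measurable [set x])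
    (p : R.-pker X ~> X) (mu : setfun X R)
    (dim_Delta : has_span_dim (Delta_ba p) 1)
    (Delta_mu : Delta_ba p = [set mu]) :
  unif_tv_cvg (cesaro_mean p) mu /\
  (simple_measure p mu -> unif_tv_cvg (markov_iter p) mu).
Proof.
have [x0 _] : exists x0 : X, True.
  apply: contrapT => /forallNP noX; apply: X_infinite.
  by rewrite (_ : [set: X] = set0) // -subset0 => x _; case: (noX x).
have mP := markov_kernel_op p.
have sigmaP := @sigma_kernel_op _ _ _ p.
(* An invariant state exists as an ultralimit of the means at [x0]; its set function lies in
   [Delta_ba], hence is [mu]. *)
have [M [iM _]] := avg_limit_invariant (fun=> x0) mP (fun k => ltnSn k).
have sM := proj1 iM.
have muM : mu = setf M by have := Delta_ba_setf iM; rewrite Delta_mu.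
rewrite muM in Delta_mu *.
have uniqM := invariant_state_unique Delta_mu sM.
split.
  apply: (unif_tv_cvg_setf sM (Q := fun n => avg n (kernel_op p))).
  - by move=> n n0; exact: markov_avg.
  - by move=> n F sF; rewrite cesaro_mean_setf.
  - exact: avg_uniform_cvg.
move=> simple; apply: (unif_tv_cvg_setf sM (Q := fun n => iter n (kernel_op p))).
- by move=> n _; exact: markov_pow.
- by move=> n F sF; rewrite markov_iter_setf.
apply: iter_uniform_cvg => // r r0.
exact: power_invariant_state_unique.
Qed.
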